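(* Let $d\ge3$ and assume (A1), (A2), (A3) of the context. With $\bar\lambda^k_j$ and $\bar\eta_j$ defined as in the context, $$\bar\lambda^k_j=\bar\eta_j=0\qquad\text{for all } j,k\in\{1,\dots,d\}.$$
   Context: Environment. $\mathbb S_{d\times d}$ is the set of real $d\times d$ positive definite diagonal matrices; an environment is a map $\omega:\mathbb Z^d\to\mathbb S_{d\times d}$, $\omega(x)=\mathrm{diag}[\omega_1(x),\dots,\omega_d(x)]$, and $\Omega$ is the set of environments. $\mathbb P$ is a probability measure on $\Omega$. $(\theta_x\omega)(\cdot)=\omega(x+\cdot)$. Assumptions: (A1) $\{\omega(x):x\in\mathbb Z^d\}$ are i.i.d. under $\mathbb P$. (A2) $\frac{\omega}{\mathrm{tr}\,\omega}\ge 2\kappa I$ $\mathbb P$-a.s., for some constant $\kappa\in(0,\frac1{2d}]$. (A3) $\zeta:\Omega\to\mathbb R$ is such that $\psi(\omega):=\zeta(\omega)/\mathrm{tr}\,\omega(0)$ is an $L^\infty(\mathbb P)$-bounded measurable function of $\omega(0)$. Operators. $e_1,\dots,e_d$ is the canonical basis; $\nabla_eu(x)=u(x+e)-u(x)$ for $e\in\{\pm e_1,\dots,\pm e_d\}$, $\nabla u=(\nabla_eu)_e$; $\nabla_i^2u(x)=u(x+e_i)+u(x-e_i)-2u(x)$, $\nabla^2u=\mathrm{diag}[\nabla_1^2u,\dots,\nabla_d^2u]$. $a(x)=\mathrm{diag}[a_1(x),\dots,a_d(x)]=\frac{\omega(x)}{\mathrm{tr}\,\omega(x)}$ and $L_\omega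 u(x)=\frac12\mathrm{tr}(a(x)\nabla^2u(x))$. Measure $\mathbb Q$. Put $\omega(x,x\pm e_i)=\frac12a_i(x)$ and let $(X_n)$ be the Markov chain on $\mathbb Z^d$ with $X_0=0$ and these transition probabilities, with law $P_\omega$. By a known theorem there is a probability measure $\mathbb Q$ on $\Omega$, mutually absolutely continuous with $\mathbb P$, such that $(\theta_{X_i}\omega)_{i\ge0}$ is an ergodic (stationary) sequence under $\mathbb Q\times P_\omega$. Let $\rho=d\mathbb Q/d\mathbb P$ and $\rho(x)=\rho_\omega(x)=\rho(\theta_x\omega)$; it is known that $\mathbb E[\exp(\rho^{c})]+\mathbb E[\exp(\rho^{-c})]<\infty$ for some $c=c(\kappa,d)>0$. Set $\bar a=\mathrm{diag}[\bar a_1,\dots,\bar a_d]=E_{\mathbb Q}[a(0)]$ and $\bar\psi=E_{\mathbb Q}[\psi]$. Correctors. By a known theorem, for $d\ge3$ and any bounded measurable function $\phi_0$ of $\omega(0)$, for $\mathbb P$-a.e. $\omega$ the equation $L_\omega\phi(x)=\phi_0(\theta_x\omega)-E_{\mathbb Q}[\phi_0]$, $x\in\mathbb Z^d$, has a solution $\phi=\phi_\omega$ on $\mathbb Z^d$, unique up to an additive constant, with $\nabla\phi_\omega(x)=\nabla\phi_{\theta_x\omega}(0)$ stationary under $\mathbb P$, $\nabla\phi(x)$ having stretched exponential moments uniformly in $x$, and $\phi(x)/\mu(|x|)$ having stretched exponential moments uniformly in $x$, where $\mu(r)=r^{1/2}$ for $d=3$, $(1\vee\log r)^{1/2}$ for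 $d=4$, and $1$ for $d\ge5$ (the ''global corrector''). Let $v^k$ ($1\le k\le d$) and $\xi$ be the global correctors solving on $\mathbb Z^d$ $$L_\omega v^k(x)=\tfrac12(a_k(x)-\bar a_k),\qquad L_\omega\xi(x)=\psi(\theta_x\omega)-\bar\psi.$$ Define (no summation) $$\lambda^k_j(x)=a_j(x)[v^k(x+e_j)-v^k(x-e_j)],\quad \bar\lambda^k_j=E_{\mathbb P}[\rho(x)\lambda^k_j(x)],\quad \eta_j(x)=a_j(x)[\xi(x+e_j)-\xi(x-e_j)],\quad \bar\eta_j=E_{\mathbb P}[\rho(x)\eta_j(x)];$$ by stationarity the averages do not depend on $x$. *)

(* Defs.v *)
From HB Require Import structures.
From mathcomp Require Import all_boot all_order all_algebra.
From mathcomp Require Import all_classical all_reals all_analysis.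

Set Implicit Arguments.
Unset Strict Implicit.
Unset Printing Implicit Defensive.

Import Order.TTheory GRing.Theory Num.Theory.
Import numFieldNormedType.Exports.

Local Open Scope classical_set_scope.
Local Open Scope ring_scope.

(* Cylinder sets of the function space I -> T over the set system G of T;
   they generate the product sigma-algebra. *)
Definition cylinders (I T : Type) (G : set (set T)) : set (set (I -> T)) :=
  [set C | exists i B, G B /\ C = [set f | B (f i)]].

Definition posdef (R : realType) (d : nat) (M : 'M[R]_d) : Prop :=
  forall u : 'rV[R]_d, u != 0 -> 0 < (u *m M *m u^T) 0 0.

Definition possemidef (R : realType) (d : nat) (M : 'M[R]_d) : Prop :=
  forall u : 'rV[R]_d, 0 <= (u *m M *m u^T) 0 0.

Record posDiag (R : realType) (d : nat) := PosDiag {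
  pd_mx :> 'M[R]_d ;
  pd_diag : is_diag_mx pd_mx ;
  pd_posdef : posdef pd_mx
}.

Section PosDiagInstances.
Variables (R : realType) (d : nat).

Lemma posdef1 : posdef (1%:M : 'M[R]_d).
Proof.
move=> u u0; rewrite mulmx1 mxE.
under eq_bigr do rewrite mxE -expr2.
rewrite lt_neqAle sumr_ge0 ?andbT => [|i _]; last exact: sqr_ge0.
apply: contra u0 => /eqP/esym/eqP; rewrite psumr_eq0 => [/allP h|i _].
  apply/eqP/rowP => i; rewrite mxE; apply/eqP.
  by rewrite -sqrf_eq0; apply: h; rewrite mem_index_enum.
exact: sqr_ge0.
Qed.

HB.instance Definition _ := gen_eqMixin (posDiag R d).
HB.instance Definition _ := gen_choiceMixin (posDiag R d).
HB.instance Definition _ := isPointed.Build (posDiag R d)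
  (PosDiag (scalar_mx_is_diag d (1 : R)) posdef1).

(* Borel sigma-algebra, generated by the matrix entries. *)
Definition posDiag_gen : set (set (posDiag R d)) :=
  [set C | exists i j (B : set R), measurable B /\ C = [set M : posDiag R d | B (M i j)]].

HB.instance Definition _ := @isMeasurable.Build (sigma_display posDiag_gen)
  (posDiag R d) <<s posDiag_gen >>
  (@sigma_algebra0 _ setT posDiag_gen) (@sigma_algebraC _ posDiag_gen)
  (@sigma_algebra_bigcup _ setT posDiag_gen).

End PosDiagInstances.

HB.instance Definition _ := isPointed.Build int 0.

Notation lattice d := 'rV[int]_d.

Definition env (R : realType) (d : nat) :=
  g_sigma_algebraType
    (cylinders (I := lattice d) (@measurable _ (posDiag R d))).

(* Paths of a chain on the lattice (which carries the discrete
   sigma-algebra). *)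
Definition path_space (d : nat) :=
  g_sigma_algebraType (cylinders (I := nat) (@setT (set (lattice d)))).

Definition env_seq (R : realType) (d : nat) :=
  g_sigma_algebraType (cylinders (I := nat) (@measurable _ (env R d))).

Section Defs.
Variables (R : realType) (d : nat).
Local Notation Zd := (lattice d).
Local Notation Env := (env R d).
Implicit Types (w : Env) (x y : Zd) (u : Zd -> R) (i j k : 'I_d).

Definition shift x w : Env := fun y => w (x + y).

Definition iid (P : probability Env R) : Prop :=
  (forall x (B : set (posDiag R d)), measurable B ->
     P [set w | B (w x)] = P [set w | B (w 0)]) /\
  (forall (s : seq Zd) (B : Zd -> set (posDiag R d)), uniq s ->
     (forall x, measurable (B x)) ->
     P [set w | forall x, x \in s -> B x (w x)] =
       (\prod_(x <- s) P [set w | B x (w x)])%E).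

Definition acoef w x : 'M[R]_d := (\tr (w x))^-1 *: (w x : 'M[R]_d).

Definition elliptic (kappa : R) (P : probability Env R) : Prop :=
  {ae P, forall w, forall x, possemidef (acoef w x - (2 * kappa)%:M)}.

Definition psi_of (zeta : Env -> R) w : R := zeta w / \tr (w 0).

Definition bounded_local (P : probability Env R) (f : Env -> R) : Prop :=
  (exists2 g : posDiag R d -> R,
     measurable_fun setT g & forall w, f w = g (w 0)) /\
  (exists C : R, {ae P, forall w, `|f w| <= C}).

Definition unit_vec i : Zd := delta_mx 0 i.

Definition unit_dir (e : Zd) : Prop :=
  exists i, e = unit_vec i \/ e = - unit_vec i.

Definition grad (e : Zd) u x : R := u (x + e) - u x.

Definition grad_norm u x : R :=
  Num.sqrt (\sum_i (grad (unit_vec i) u x ^+ 2 + grad (- unit_vec i) u x ^+ 2)).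

Definition hess u x : 'M[R]_d :=
  diag_mx (\row_i (u (x + unit_vec i) + u (x - unit_vec i) - 2 * u x)).

Definition Lop w u x : R := 2^-1 * \tr (acoef w x *m hess u x).

Definition trans w x y : R :=
  \sum_i 2^-1 * acoef w x i i *
    ((y == x + unit_vec i)%:R + (y == x - unit_vec i)%:R).

(* Pw w is the law P_w of the chain started at 0 in the environment w; the
   probabilities of these cylinders determine it. *)
Definition quenched_law (Pw : R.-pker Env ~> path_space d) : Prop :=
  forall w (n : nat) (x : nat -> Zd),
    Pw w [set X : path_space d | forall m, (m <= n)%N -> X m = x m] =
      ((x 0%N == 0)%:R * \prod_(m < n) trans w (x m) (x m.+1))%:E.

(* Probability under Q x P_w of an event on (environment, path) pairs. *)
Definition annealed (Q : probability Env R) (Pw : R.-pker Env ~> path_space d)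
    (E : set (Env * path_space d)) : \bar R :=
  (\int[Q]_w Pw w [set X | E (w, X)])%E.

Definition env_from_walker (wX : Env * path_space d) : env_seq R d :=
  fun n => shift (wX.2 n) wX.1.

Definition time_shift (s : env_seq R d) : env_seq R d := fun n => s n.+1.

Definition env_seq_law Q Pw (B : set (env_seq R d)) : \bar R :=
  annealed Q Pw (env_from_walker @^-1` B).

Definition env_stationary Q Pw : Prop :=
  forall B : set (env_seq R d), measurable B ->
    env_seq_law Q Pw (time_shift @^-1` B) = env_seq_law Q Pw B.

Definition env_ergodic Q Pw : Prop :=
  forall B : set (env_seq R d), measurable B -> time_shift @^-1` B = B ->
    env_seq_law Q Pw B = 0%E \/ env_seq_law Q Pw B = 1%E.

Definition invariant_measure (P Q : probability Env R)
    (Pw : R.-pker Env ~> path_space d) : Prop :=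
  [/\ Q `<< P, P `<< Q, env_stationary Q Pw & env_ergodic Q Pw].

(* rho is a version of the Radon-Nikodym derivative dQ/dP. *)
Definition density (P Q : probability Env R) (rho : Env -> R) : Prop :=
  [/\ measurable_fun setT rho, forall w, 0 <= rho w &
      forall A, measurable A -> Q A = (\int[P]_(w in A) (rho w)%:E)%E].

(* The value of rho w `^ (- c) on [rho = 0] is irrelevant: that set is null
   since P and Q are mutually absolutely continuous. *)
Definition density_moments (P : probability Env R) (rho : Env -> R) : Prop :=
  exists2 c : R, 0 < c &
    ('E_P[fun w => expR (rho w `^ c)] +
     'E_P[fun w => expR (rho w `^ (- c))] < +oo)%E.

Definition uniform_stretched_exp (P : probability Env R)
    (f : Zd -> Env -> R) : Prop :=
  exists q c C : R, [/\ 0 < q, 0 < c &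
    forall x, ('E_P[fun w => expR (c * `|f x w| `^ q)] <= C%:E)%E].

Definition enorm x : R := Num.sqrt (\sum_i ((x 0 i)%:~R : R) ^+ 2).

Definition growth (r : R) : R :=
  if d == 3 then Num.sqrt r
  else if d == 4 then Num.sqrt (Num.max 1 (ln r))
  else 1.

(* Global corrector for the right-hand side phi0 o shift_x - E_Q[phi0], as a
   random field phi : environment -> site -> value. For d = 3 and x = 0 one
   divides by growth 0 = 0, so (as r / 0 = 0) the growth bound says nothing at the
   origin. Uniqueness up to an additive constant is not assumed. *)
Record global_corrector (P Q : probability Env R) (phi0 : Env -> R)
    (phi : Env -> Zd -> R) : Prop := GlobalCorrector {
  gc_measurable : forall x, measurable_fun setT (phi ^~ x) ;
  gc_eq : {ae P, forall w, forall x,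
    Lop w (phi w) x = phi0 (shift x w) - (\int[Q]_w' phi0 w')%R} ;
  gc_stationary : {ae P, forall w, forall x e, unit_dir e ->
    grad e (phi w) x = grad e (phi (shift x w)) 0} ;
  gc_grad_moments :
    uniform_stretched_exp P (fun x w => grad_norm (phi w) x) ;
  gc_growth : uniform_stretched_exp P (fun x w => phi w x / growth (enorm x))
}.

(* For phi = v^k this is lambda^k_j(x), for phi = xi it is eta_j(x). *)
Definition flux (phi : Env -> Zd -> R) j x w : R :=
  acoef w x j j * (phi w (x + unit_vec j) - phi w (x - unit_vec j)).

Definition mean_flux (P : probability Env R) (rho : Env -> R)
    (phi : Env -> Zd -> R) j x : \bar R :=
  'E_P[fun w => rho (shift x w) * flux phi j x w].

End Defs.

(* Main.v *)
Require Import Defs.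
From HB Require Import structures.
From mathcomp Require Import all_boot all_order all_algebra.
From mathcomp Require Import all_classical all_reals all_analysis.
From mathcomp Require Import measurable_realfun.
From mathcomp Require Import ring lra.
Import Order.TTheory GRing.Theory Num.Theory.
Import numFieldNormedType.Exports.
Set Implicit Arguments.
Unset Strict Implicit.
Unset Printing Implicit Defensive.

Local Open Scope classical_set_scope.
Local Open Scope ring_scope.

(** The i.i.d. law P is invariant under the mirror map T : w(x) -> w(-x), and
    since the matrices are diagonal, the mirror image phi(Tw)(-x) of a corrector
    solves the same equation as phi, while the mirror image of a flux is minus
    the flux. So the mean flux vanishes once rho and grad phi are shown to be
    mirror symmetric, which are two uniqueness statements.

    (1) rho o T = rho. Both are fixed by the adjoint of the one-step operator of
    the environment seen from the walker. For the difference f of two fixed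
    densities, |f| is fixed too, so g = |f| + f >= 0 is fixed, and then {g = 0} is
    a shift invariant event, which is trivial by ergodicity; as f has mean 0,
    it vanishes.

    (2) rho grad u = 0 for u(w)(x) = phi(w)(x) - phi(Tw)(-x), which is harmonic,
    has stationary gradient and grows like |x|^(1/2). As rho is a stationary
    solution of the adjoint equation, the mean of sum_x rho(x) L(chi u^2)(x) is 0
    for finitely supported chi. Moving the differences off chi, the energy
    E[rho sum_e w_e |grad_e u|^2], a constant in x, equals a discrete divergence:
    second differences of the means of rho w_e u^2 = O(|x|) plus first
    differences of the means of rho w_e u grad_e u = o(|x|). Averaging
    over large boxes kills both. *)

Local Notation shift := Defs.shift.

(** * Averages over boxes *)

Section Averages.
Context {R : realType} {d : nat}.
Local Notation Zd := (lattice d).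
Implicit Types (e x y : Zd) (f g h : Zd -> R) (s : seq Zd) (K c : R) (N : nat).

Definition l1 x : R := \sum_i `|(x 0 i)%:~R|.

Lemma l1_0 : l1 0 = 0.
Proof. by apply: big1 => i _; rewrite mxE normr0. Qed.

Lemma l1_ge0 x : 0 <= l1 x.
Proof. exact: sumr_ge0. Qed.

Lemma l1D x y : l1 (x + y) <= l1 x + l1 y.
Proof. by rewrite -big_split; apply: ler_sum => i _; rewrite mxE intrD ler_normD. Qed.

Lemma l1N x : l1 (- x) = l1 x.
Proof. by apply: eq_bigr => i _; rewrite mxE rmorphN normrN. Qed.

Lemma l1Mn e k : l1 e <= 1 -> l1 (e *+ k) <= k%:R.
Proof.
move=> e1; elim: k => [|k ih]; first by rewrite mulr0n l1_0.
by rewrite mulrS -natr1 addrC (le_trans (l1D _ _))// lerD.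
Qed.

Definition affine_bound K c f := forall x, `|f x| <= K + c * l1 x.

Definition avg N e f x : R := N%:R^-1 * \sum_(k < N) f (x + e *+ k).

(** Averaging successively along every direction in [s] amounts to a box average. A list holding
    both [e] and [- e] averages twice along that axis, which lets a second difference telescope
    twice. *)
Definition avgs N s f := foldr (avg N) f s.

Lemma eq_avg N e f g : f =1 g -> avg N e f =1 avg N e g.
Proof. by move=> fg x; congr (_ * _); apply: eq_bigr => k _; exact: fg. Qed.

Lemma eq_avgs N s f g : f =1 g -> avgs N s f =1 avgs N s g.
Proof. by move=> fg; elim: s => //= e s ih; exact: eq_avg. Qed.

Lemma avgC N e e' f : avg N e (avg N e' f) =1 avg N e' (avg N e f).
Proof.
move=> x; rewrite /avg; congr (_ * _).
rewrite -!mulr_sumr exchange_big/=; congr (_ * _).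
by apply: eq_bigr => i _; apply: eq_bigr => j _; rewrite addrAC.
Qed.

Lemma avgs_avg N s e f : avgs N s (avg N e f) =1 avg N e (avgs N s f).
Proof.
elim: s => //= e' s ih x.
by rewrite (eq_avg _ _ ih) avgC.
Qed.

(** Averages in different directions commute, so the one along [e] can be made to act first,
    directly on a gradient along [e]. *)
Lemma avgs_rem N s e f : e \in s -> avgs N s f =1 avgs N (rem e s) (avg N e f).
Proof.
elim: s => //= e' s ih; rewrite inE eq_sym; case: eqVneq => [-> _ x|_ /= es x].
  by rewrite avgs_avg.
exact/eq_avg/ih.
Qed.

Lemma avgs_cst N s c : (0 < N)%N -> avgs N s (cst c) =1 cst c.
Proof.
move=> N0; elim: s => //= e s ih x; rewrite (eq_avg _ _ ih) /avg/=.
by rewrite sumr_const card_ord -[c *+ N]mulr_natl mulKf// pnatr_eq0 -lt0n.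
Qed.

Lemma avgD N e f g : avg N e (fun x => f x + g x) =1 fun x => avg N e f x + avg N e g x.
Proof. by move=> x; rewrite /avg big_split mulrDr. Qed.

Lemma avgs_sum N s (I : Type) (r : seq I) (F : I -> Zd -> R) :
  avgs N s (fun x => \sum_(i <- r) F i x) =1 fun x => \sum_(i <- r) avgs N s (F i) x.
Proof.
elim: s => //= e s ih x; rewrite (eq_avg _ _ ih) /avg.
by rewrite exchange_big/= mulr_sumr.
Qed.

Lemma avgsD N s f g : avgs N s (fun x => f x + g x) =1 fun x => avgs N s f x + avgs N s g x.
Proof. by elim: s => //= e s ih x; rewrite (eq_avg _ _ ih) avgD. Qed.

Lemma avg_grad N e f : avg N e (grad e f) =1 fun x => N%:R^-1 * grad (e *+ N) f x.
Proof.
move=> x; congr (_ * _); rewrite /grad.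
elim: N => [|N ih]; first by rewrite big_ord0 mulr0n addr0 subrr.
by rewrite big_ord_recr/= ih mulrSr [x + (_ + _)]addrA; ring.
Qed.

Lemma avg_affine N e K c f : (0 < N)%N -> 0 <= c -> l1 e <= 1 ->
  affine_bound K c f -> affine_bound (K + c * N%:R) c (avg N e f).
Proof.
move=> N0 c0 e1 fK x; rewrite normrM ger0_norm ?invr_ge0// ler_pdivrMl ?ltr0n//.
apply: (le_trans (ler_norm_sum _ _ _)).
rewrite mulr_natl -[X in _ *+ X]card_ord -sumr_const; apply: ler_sum => k _.
apply: (le_trans (fK _)); rewrite -addrA lerD2l -mulrDr ler_wpM2l//.
rewrite (le_trans (l1D _ _))// addrC lerD2r (le_trans (l1Mn _ e1))//.
by rewrite ler_nat ltnW.
Qed.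

Lemma avgs_affine N s K c f : (0 < N)%N -> 0 <= c ->
  (forall e, e \in s -> l1 e <= 1) ->
  affine_bound K c f -> affine_bound (K + (size s)%:R * (c * N%:R)) c (avgs N s f).
Proof.
move=> N0 c0; elim: s => [|e s ih]/= s1 fK; first by rewrite mul0r addr0.
rewrite -natr1 mulrDl mul1r addrA; apply: avg_affine => //.
  by apply: s1; rewrite inE eqxx.
by apply: ih => // e' e's; apply: s1; rewrite inE e's orbT.
Qed.

Lemma grad_affine N e K c f : (0 < N)%N -> 0 <= c -> l1 e <= 1 ->
  affine_bound K c f ->
  affine_bound (N%:R^-1 * (2 * K + c * N%:R)) (N%:R^-1 * (2 * c))
    (fun x => N%:R^-1 * grad (e *+ N) f x).
Proof.
move=> N0 c0 e1 fK x; rewrite normrM ger0_norm ?invr_ge0// -mulrA -mulrDr.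
rewrite ler_wpM2l ?invr_ge0//.
have := ler_normB (f (x + e *+ N)) (f x).
have := fK x; have := fK (x + e *+ N); rewrite /grad.
have : c * l1 (x + e *+ N) <= c * (l1 x + N%:R).
  by rewrite ler_wpM2l// (le_trans (l1D _ _))// lerD2l l1Mn.
lra.
Qed.

(** Telescoping along [e] gains a factor [1/N], while the other averages reach to distance at most
    of order [N]. The constant part decays, and the slope leaves a multiple of [c], to be made small
    through [c] itself. *)
Lemma avgs_grad_le N s e K c f : (0 < N)%N -> 0 <= c ->
  (forall e, e \in s -> l1 e <= 1) -> e \in s -> affine_bound K c f ->
  `|avgs N s (grad e f) 0| <= 2 * K / N%:R + c * (1 + 2 * (size s)%:R).
Proof.
move=> N0 c0 s1 es fK.
have sz : (0 < size s)%N by case: (s) es.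
rewrite (avgs_rem _ _ es) (eq_avgs _ _ (avg_grad _ _ _)).
have s1' e' : e' \in rem e s -> l1 e' <= 1 by move/mem_rem/s1.
have c0' : 0 <= N%:R^-1 * (2 * c) by rewrite mulr_ge0 ?invr_ge0// mulr_ge0.
apply: (le_trans (avgs_affine N0 c0' s1' (grad_affine N0 c0 (s1 _ es) fK) 0)).
rewrite l1_0 mulr0 addr0 size_rem//.
have N0' : N%:R != 0 :> R by rewrite pnatr_eq0 -lt0n.
have -> : N%:R^-1 * (2 * K + c * N%:R) + (size s).-1%:R * (N%:R^-1 * (2 * c) * N%:R) =
    2 * K / N%:R + c * (1 + 2 * (size s).-1%:R) by field.
rewrite lerD2l ler_wpM2l// lerD2l ler_wpM2l// ler_nat leq_pred//.
Qed.

(** The sum telescopes along [e] and then along [e']; [e != e'] ensures that [e'] is still in the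
    list once [e] has been removed. *)
Lemma avgs_grad2_le N s e e' K c f : (0 < N)%N -> 0 <= c ->
  (forall e, e \in s -> l1 e <= 1) -> e \in s -> e' \in s -> e != e' ->
  affine_bound K c f ->
  `|avgs N s (grad e (grad e' f)) 0| <=
    2 * (N%:R^-1 * (2 * K + c * N%:R)) / N%:R + N%:R^-1 * (2 * c) * (1 + 2 * (size s)%:R).
Proof.
move=> N0 c0 s1 es es' ee fK.
rewrite (avgs_rem _ _ es) (eq_avgs _ _ (avg_grad _ _ _)).
have s1' e0 : e0 \in rem e s -> l1 e0 <= 1 by move/mem_rem/s1.
have c0' : 0 <= N%:R^-1 * (2 * c) by rewrite mulr_ge0 ?invr_ge0// mulr_ge0.
have er : e' \in rem e s by apply: rem_mem; rewrite // eq_sym.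
have -> : avgs N (rem e s) (fun x => N%:R^-1 * grad (e *+ N) (grad e' f) x) 0 =
    avgs N (rem e s) (grad e' (fun x => N%:R^-1 * grad (e *+ N) f x)) 0.
  by apply: eq_avgs => x; rewrite /grad [x + e' + _]addrAC; ring.
apply: (le_trans (avgs_grad_le N0 c0' s1' er (grad_affine N0 c0 (s1 _ es) fK))).
rewrite lerD2l ler_wpM2l// lerD2l ler_wpM2l// ler_nat.
exact: size_subseq (rem_subseq _ _).
Qed.

(* The averages of a gradient (resp. Hessian) of a sublinear (resp. subquadratic)
   function over boxes of side N vanish as N grows. *)
Lemma sublinear_divergence_eq0 (D C : R) s (h G : Zd -> Zd -> R) : 0 <= C ->
  (forall e, e \in s -> [/\ l1 e <= 1, - e \in s & e != - e]) ->
  (forall e, e \in s -> forall x, `|h e x| <= C * (1 + l1 x)) ->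
  (forall e, e \in s -> forall x eps, 0 < eps ->
     `|G e x| <= C * (eps * (1 + l1 x) + eps^-1)) ->
  (forall x, D = \sum_(e <- s) grad e (grad (- e) (h e)) x +
                 \sum_(e <- s) grad (- e) (G e) x) ->
  D = 0.
Proof.
move=> C0 hs hh hG hD.
set S := (size s)%:R : R.
have S0 : 0 <= S by [].
(* A bound of order [1/n] for every positive [n] forces [D = 0] by the Archimedean property. *)
suff Dn n : (0 < n)%N -> `|D| * n%:R <= S * (C * (13 + 6 * S)).
  apply/eqP/negP => /negP D0; have D1 : 0 < `|D| by rewrite normr_gt0.
  set B := S * (C * (13 + 6 * S)) in Dn.
  have := Dn (Num.truncn (B / `|D|)).+1 isT.
  apply/negP; rewrite -ltNge -ltr_pdivrMl// mulrC.
  exact: truncnS_gt.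
(* Side [N = n^2] with [eps = 1/n] makes both contributions [O(1/n)]: averaged second differences
   are [O(1/N)], while [G] has slope [C/n] and a constant part of order [C n], which is divided by
   [N]. *)
move=> n0; pose N := (n * n)%N; have N0 : (0 < N)%N by rewrite muln_gt0 n0.
have s1 e : e \in s -> l1 e <= 1 by case/hs.
have n0' : 0 < n%:R :> R by rewrite ltr0n.
have n1' : 1 <= n%:R :> R by rewrite ler1n.
have n00 : n%:R != 0 :> R by rewrite gt_eqF.
have NE : N%:R = n%:R * n%:R :> R by rewrite natrM.
have -> : D = \sum_(e <- s) (avgs N s (grad e (grad (- e) (h e))) 0 +
                             avgs N s (grad (- e) (G e)) 0).
  rewrite big_split/= -(avgs_sum _ _ _ _ 0) -(avgs_sum _ _ _ _ 0) -(avgsD _ _ _ _ 0).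
  by rewrite -(eq_avgs _ _ hD) (avgs_cst _ _ N0).
rewrite -ler_pdivlMr//; apply: (le_trans (ler_norm_sum _ _ _)).
apply: (@le_trans _ _ (\sum_(e <- s) C * (13 + 6 * S) / n%:R)); last first.
  by rewrite big_const_seq count_predT iter_addr_0 -[leLHS]mulr_natl -/S !mulrA.
rewrite !big_seq; apply: ler_sum => e es.
have [e1 e's ee'] := hs _ es.
have hK : affine_bound C C (h e) by move=> x; have := hh _ es x; lra.
have GK : affine_bound (C * (n%:R^-1 + n%:R)) (C * n%:R^-1) (G e).
  move=> x; have := hG _ es x n%:R^-1; rewrite invr_gt0 => /(_ n0').
  by rewrite invrK; lra.
have Cn0 : 0 <= C * n%:R^-1 by rewrite mulr_ge0// invr_ge0.
have := avgs_grad2_le N0 C0 s1 es e's ee' hK.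
have := avgs_grad_le N0 Cn0 s1 e's GK.
rewrite -/S NE => b1 b2.
apply: (le_trans (ler_normD _ _)); apply: (le_trans (lerD b2 b1)).
have i0 : 0 < n%:R^-1 :> R by rewrite invr_gt0.
have i1 : n%:R^-1 <= 1 :> R by rewrite invf_le1.
rewrite !invfM.
have nK : n%:R^-1 * n%:R = 1 :> R by rewrite mulVf.
set i : R := n%:R^-1 in i0 i1 nK *; set m : R := n%:R in nK *.
(* As [i * m = 1] and [i <= 1], the six terms of the last bracket are at most [4], [2], [2 + 4S],
   [2], [2] and [1 + 2S], with sum [13 + 6S]. *)
have -> : 2 * (i * i * (2 * C + C * (m * m))) * (i * i) +
    i * i * (2 * C) * (1 + 2 * S) + (2 * (C * (i + m)) * (i * i) + C * i * (1 + 2 * S)) =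
    C * i * (4 * i ^+ 3 + 2 * i * (i * m) ^+ 2 + 2 * i * (1 + 2 * S) + 2 * i ^+ 2 + 2 * (i * m) + (1 + 2 * S)) by ring.
rewrite nK expr1n !mulr1 [leRHS]mulrAC ler_wpM2l//.
have i2 : i ^+ 2 <= 1 by rewrite expr_le1// ltW.
have i3 : i ^+ 3 <= 1 by rewrite expr_le1// ltW.
have iS : i * S <= S by rewrite ler_piMl.
lra.
Qed.

End Averages.

(** * Relabelling the sites of an i.i.d. environment *)

Lemma ae_forall_countable {dT} {T : measurableType dT} {R : realType}
    (mu : {measure set T -> \bar R}) (I : countType) (A : I -> T -> Prop) :
  (forall i, {ae mu, forall t, A i t}) -> {ae mu, forall t, forall i, A i t}.
Proof.
move=> hA.
have : {ae mu, forall t, forall n, if unpickle n is Some i then A i t else True}.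
  apply: ae_foralln => n; case: unpickle => [i|]; first exact: hA.
  exact: aeW.
by apply: filterS => t h i; have := h (pickle i); rewrite pickleK.
Qed.

Lemma measurable_forall_countable {dT} {T : measurableType dT} (I : countType)
    (A : I -> set T) :
  (forall i, measurable (A i)) -> measurable [set t | forall i, A i t].
Proof.
move=> mA.
have -> : [set t | forall i, A i t] =
    \bigcap_n (if unpickle n is Some i then A i else setT).
  rewrite eqEsubset; split => t /= h.
    by move=> n _; case: unpickle => // i; exact: h.
  by move=> i; have := h (pickle i) Logic.I; rewrite pickleK.
by apply: bigcapT_measurable => n; case: unpickle.
Qed.

Lemma measurable_exists_countable {dT} {T : measurableType dT} (I : countType)
    (A : I -> set T) :
  (forall i, measurable (A i)) -> measurable [set t | exists i, A i t].
Proof.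
move=> mA; have -> : [set t | exists i, A i t] = ~` [set t | forall i, (~` A i) t].
  rewrite eqEsubset; split => t /=; first by move=> [i Ai] /(_ i).
  by move/existsNP => [i /contrapT]; exists i.
by apply: measurableC; apply: measurable_forall_countable => i; exact: measurableC.
Qed.

Section Environment.
Context {R : realType} {d : nat}.
Local Notation Zd := (lattice d).
Local Notation Env := (env R d).

Lemma measurable_site (x : Zd) : measurable_fun setT (fun w : Env => w x).
Proof.
move=> _ B mB; rewrite setTI; apply: sub_sigma_algebra.
by exists x, B.
Qed.

Lemma measurable_to_env {dT} (T : measurableType dT) (f : T -> Env) :
  (forall x, measurable_fun setT (fun t => f t x)) -> measurable_fun setT f.
Proof.
move=> mf; refine (@measurability _ _ T Env setT f (cylinders (I := lattice d) (@measurable _ (posDiag R d))) _ _).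
  by [].
move=> _ [_ [x [B [mB ->]]] <-].
exact: mf.
Qed.

(** Covers both the shifts, [tau y = x + y], and the mirror map, [tau y = - y]. *)
Definition relabel (tau : Zd -> Zd) (w : Env) : Env := fun x => w (tau x).

Lemma measurable_relabel tau : measurable_fun setT (relabel tau).
Proof. by apply: measurable_to_env => x; exact: measurable_site. Qed.

Lemma measurable_entry x i j : measurable_fun setT (fun w : Env => (w x : 'M[R]_d) i j).
Proof.
apply: (measurableT_comp (f := fun M : posDiag R d => (M : 'M[R]_d) i j)); last exact: measurable_site.
move=> _ B mB; rewrite setTI; apply: sub_sigma_algebra.
by exists i, j, B.
Qed.

Section Invariance.
Variables (P : probability Env R) (iidP : iid P).
Variables (tau : Zd -> Zd) (tau_inj : injective tau).

(** Cylinders constraining finitely many sites at once: unlike the one-site cylinders that define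
    the sigma-algebra, they are stable under intersection, as the uniqueness theorem for measures
    requires. *)
Let G : set (set Env) := [set C | exists (s : seq Zd) (B : Zd -> set (posDiag R d)),
  [/\ uniq s, (forall x, measurable (B x)) &
      C = [set w : Env | forall x, x \in s -> B x (w x)]]].

Let GE : (@measurable _ Env : set (set Env)) = <<s G >>.
Proof.
rewrite eqEsubset; split.
  apply: smallest_sub; first exact: smallest_sigma_algebra.
  move=> _ [x [B [mB ->]]]; apply: sub_sigma_algebra.
  exists [:: x], (fun _ => B); split => //.
  rewrite eqEsubset; split => w /= h; last by apply: h; rewrite inE.
  by move=> y; rewrite inE => /eqP ->.
apply: smallest_sub; first exact: sigma_algebra_measurable.
move=> _ [s [B [_ mB ->]]].
have -> : [set w : Env | forall x, x \in s -> B x (w x)] =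
    [set w : Env | forall x, (if x \in s then (fun w : Env => w x) @^-1` B x else setT) w].
  rewrite eqEsubset; split => w /= h x; have := h x; case: (x \in s) => //.
  exact.
apply: measurable_forall_countable => x; case: ifP => // _.
by rewrite -[X in measurable X]setTI; exact: measurable_site.
Qed.

Let GI : setI_closed G.
Proof.
move=> _ _ [s [B [us mB ->]]] [t [C [ut mC ->]]].
exists (undup (s ++ t)), (fun x => (if x \in s then B x else setT) `&` (if x \in t then C x else setT)).
split; first exact: undup_uniq.
  by move=> x; apply: measurableI; case: ifP.
rewrite eqEsubset; split => w /=.
  move=> [h1 h2] x _; split; case: ifP => //; [exact: h1|exact: h2].
move=> h; split=> x xs; have := h x; rewrite mem_undup mem_cat xs ?orbT => /(_ isT)[].
  by [].
by [].
Qed.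

(** By injectivity distinct sites are relabelled to distinct sites, so independence factorises both
    sides, and the one-site laws agree. *)
Let iid_cylinder (s : seq Zd) (B : Zd -> set (posDiag R d)) : uniq s ->
    (forall x, measurable (B x)) ->
  P (relabel tau @^-1` [set w : Env | forall x, x \in s -> B x (w x)]) =
  P [set w : Env | forall x, x \in s -> B x (w x)].
Proof.
move=> us mB; have [iid1 iid2] := iidP.
(* The constraint carried to the site [y], without inverting [tau]: it is [B x] if [y = tau x], and
   no constraint if [y] is not in the image. *)
pose B' (y : Zd) : set (posDiag R d) := [set m | forall x, tau x = y -> B x m].
have B'E x : B' (tau x) = B x.
  by rewrite eqEsubset; split => m /= h; [exact: h|move=> x' /tau_inj ->].
have mB' y : measurable (B' y).
  have -> : B' y = [set m | forall x, (if tau x == y then B x else setT) m].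
    rewrite eqEsubset; split => m /= h x; have := h x.
      by case: eqP => // e; exact.
    by move=> + e; rewrite e eqxx.
  by apply: measurable_forall_countable => x; case: ifP.
have -> : relabel tau @^-1` [set w : Env | forall x, x \in s -> B x (w x)] =
    [set w : Env | forall y, y \in map tau s -> B' y (w y)].
  rewrite eqEsubset; split => w /= h.
    by move=> _ /mapP[x xs ->]; rewrite B'E; exact: h.
  by move=> x xs; rewrite /relabel -B'E; apply: h; rewrite map_f.
rewrite iid2//; last by rewrite map_inj_uniq.
rewrite iid2// big_map; apply: eq_bigr => x _.
by rewrite B'E iid1// [RHS]iid1.
Qed.

Lemma iid_relabel (A : set Env) : measurable A -> P (relabel tau @^-1` A) = P A.
Proof.
move=> mA; have mT := measurable_relabel tau.
change (pushforward P (relabel tau) A = P A).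
apply: (measure_unique G (fun _ => setT)) => //.
- move=> _; exists [::], (fun _ => setT); split => //.
  by rewrite eqEsubset; split.
- by rewrite bigcup_const//; exists 0%N.
- move=> _ [s [B [us mB ->]]]; exact: iid_cylinder.
- by move=> _; rewrite [ltLHS](_ : _ = 1%E) ?ltry//; exact: probability_setT.
Qed.
End Invariance.
End Environment.

(** * Nearest-neighbour steps and their weights *)

Section Steps.
Context {R : realType} {d : nat}.
Local Notation Zd := (lattice d).
Local Notation Env := (env R d).
Implicit Types (w : Env) (x y e : Zd) (i j : 'I_d).

Definition steps : seq Zd :=
  [seq unit_vec i | i <- index_enum 'I_d] ++ [seq - unit_vec i | i <- index_enum 'I_d].

Lemma unit_vec_inj : injective (@unit_vec d).
Proof.
move=> i j /matrixP/(_ 0 i); rewrite !mxE !eqxx/=.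
by case: eqVneq.
Qed.

Lemma unit_vecN i j : unit_vec i != - unit_vec j.
Proof.
apply/eqP => /matrixP/(_ 0 i); rewrite !mxE !eqxx/=.
by case: eqVneq.
Qed.

Lemma stepsP e : reflect (unit_dir e) (e \in steps).
Proof.
rewrite mem_cat; apply: (iffP orP).
  by case=> /mapP[i _ ->]; exists i; [left|right].
by move=> [i [->|->]]; [left|right]; apply: map_f; rewrite mem_index_enum.
Qed.

Lemma steps_unit i : unit_vec i \in steps.
Proof. by apply/stepsP; exists i; left. Qed.

Lemma stepsN e : (- e \in steps) = (e \in steps).
Proof.
suff H x : x \in steps -> - x \in steps.
  by apply/idP/idP => /H //; rewrite opprK.
by move=> /stepsP[i [->|->]]; apply/stepsP; exists i; rewrite ?opprK; [right|left].
Qed.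

Lemma steps_neqN e : e \in steps -> e != - e.
Proof.
move=> /stepsP[i [->|->]]; rewrite ?opprK; first exact: unit_vecN.
by rewrite eq_sym unit_vecN.
Qed.

Lemma steps_uniq : uniq steps.
Proof.
have -> : uniq steps = ~~ has (mem [seq unit_vec i | i <- index_enum 'I_d])
    [seq - unit_vec i | i <- index_enum 'I_d].
  rewrite cat_uniq map_inj_uniq ?index_enum_uniq//=; last exact: unit_vec_inj.
  by rewrite map_inj_uniq ?index_enum_uniq ?andbT// => i j /oppr_inj/unit_vec_inj.
apply/hasPn => _ /mapP[i _ ->].
by apply/mapP => -[j _ /esym/eqP]; apply/negP; exact: unit_vecN.
Qed.

Lemma l1_steps e : e \in steps -> l1 e <= 1 :> R.
Proof.
suff H i : l1 (unit_vec i) = 1 :> R.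
  by move=> /stepsP[i [->|->]]; rewrite ?l1N H.
rewrite /l1 (bigD1 i)//= mxE !eqxx/= normr1 big1 ?addr0// => j ji.
by rewrite mxE eqxx (negbTE ji) normr0.
Qed.

Lemma big_steps (F : Zd -> R) :
  \sum_(e <- steps) F e = \sum_i (F (unit_vec i) + F (- unit_vec i)).
Proof. by rewrite big_cat !big_map big_split. Qed.

Lemma big_stepsN (F : Zd -> R) : \sum_(e <- steps) F (- e) = \sum_(e <- steps) F e.
Proof. by rewrite !big_steps; apply: eq_bigr => i _; rewrite opprK addrC. Qed.

(** The lattice is connected by unit steps: from the origin, walk along one coordinate axis after
    the other, forwards or backwards according to the sign of the coordinate. *)
Lemma lattice_ind (A : Zd -> Prop) : A 0 ->
  (forall x e, e \in steps -> A x -> A (x + e)) -> forall x, A x.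
Proof.
move=> A0 AS x.
suff H (r : seq 'I_d) y : A y -> A (y + \sum_(i <- r) delta_mx 0 i *~ x 0 i).
  have -> : x = 0 + \sum_(i <- index_enum 'I_d) delta_mx 0 i *~ x 0 i; last exact: H.
  rewrite add0r [LHS]row_sum_delta; apply: eq_bigr => i _.
  by rewrite -[x 0 i in LHS]intz scaler_int.
elim: r y => [|i r ih] y Ay; first by rewrite big_nil addr0.
rewrite big_cons addrA; apply: ih.
have up n z e : e \in steps -> A z -> A (z + e *+ n).
  move=> es Az; elim: n => [|n ihn]; first by rewrite mulr0n addr0.
  by rewrite mulrSr addrA; exact: AS.
case: (x 0 i) => n.
  by rewrite -pmulrn; apply: up => //; exact: steps_unit.
by rewrite NegzE mulrNz -pmulrn -mulNrn; apply: up => //; rewrite stepsN steps_unit.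
Qed.

Hypothesis d_gt0 : (0 < d)%N.

Lemma posDiag_gt0 (M : posDiag R d) i : 0 < (M : 'M[R]_d) i i.
Proof.
have := @pd_posdef _ _ M (delta_mx 0 i); rewrite -rowE.
have -> : (row i M *m (delta_mx 0 i : 'rV[R]_d)^T) 0 0 = (M : 'M[R]_d) i i.
  rewrite mxE (bigD1 i)//= !mxE !eqxx mulr1 big1 ?addr0// => j ji.
  by rewrite !mxE (negbTE ji) mulr0.
apply; apply/eqP => /matrixP/(_ 0 i)/eqP; rewrite !mxE !eqxx/=.
by rewrite oner_eq0.
Qed.

Lemma tr_gt0 (M : posDiag R d) : 0 < \tr M.
Proof.
rewrite /mxtrace (bigD1 (Ordinal d_gt0))//= ltr_pwDl ?posDiag_gt0//.
by apply: sumr_ge0 => i _; rewrite ltW// posDiag_gt0.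
Qed.

Lemma acoef_gt0 w x i : 0 < acoef w x i i.
Proof. by rewrite mxE mulr_gt0 ?invr_gt0 ?tr_gt0 ?posDiag_gt0. Qed.

Lemma sum_acoef w x : \sum_i acoef w x i i = 1.
Proof.
under eq_bigr do rewrite mxE.
by rewrite -mulr_sumr mulVf// gt_eqF ?tr_gt0.
Qed.

Lemma measurable_acoef x i j : measurable_fun setT (fun w => acoef w x i j).
Proof.
(* The inverse of the trace becomes a power of exponent [-1], legitimate because the trace is
   positive, so that measurability follows from that of the power function. *)
have -> : (fun w => acoef w x i j) = fun w => (\tr (w x)) `^ (-1) * (w x : 'M[R]_d) i j.
  by apply/funext => w; rewrite mxE powR_inv1// ltW// tr_gt0.
apply: measurable_funM; last exact: measurable_entry.
apply: (measurableT_comp (f := fun r : R => r `^ (-1))) => //.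
by apply: measurable_sum => k; exact: measurable_entry.
Qed.

(** Probability of the step [e] from the origin; at a site [x] the same probability reads
    [wt e (shift x w)]. *)
Definition wt e w : R := trans w 0 e.

Lemma wt_unit w i : wt (unit_vec i) w = 2^-1 * acoef w 0 i i.
Proof.
rewrite /wt /trans (bigD1 i)//= add0r eqxx sub0r (negbTE (unit_vecN _ _)) addr0 mulr1.
rewrite big1 ?addr0// => j ji.
by rewrite add0r sub0r (inj_eq unit_vec_inj) eq_sym (negbTE ji) (negbTE (unit_vecN _ _)) addr0 mulr0.
Qed.

Lemma wtN e w : wt (- e) w = wt e w.
Proof.
by apply: eq_bigr => i _; rewrite !add0r eqr_opp eqr_oppLR addrC.
Qed.

Lemma wt_gt0 e w : e \in steps -> 0 < wt e w.
Proof.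
by move=> /stepsP[i [->|->]]; rewrite ?wtN wt_unit mulr_gt0 ?invr_gt0 ?acoef_gt0.
Qed.

Lemma sum_wt w : \sum_(e <- steps) wt e w = 1.
Proof.
rewrite big_steps -[RHS](sum_acoef w 0); apply: eq_bigr => i _.
by rewrite wtN wt_unit; field.
Qed.

Lemma wt_le1 e w : e \in steps -> wt e w <= 1.
Proof.
move=> es; rewrite -(sum_wt w) (big_rem e)//= lerDl big_seq sumr_ge0// => e' /mem_rem es'.
by rewrite ltW// wt_gt0.
Qed.

Lemma measurable_wt e : measurable_fun setT (wt e).
Proof.
apply: measurable_sum => i; apply: measurable_funM => //.
by apply: measurable_funM => //; exact: measurable_acoef.
Qed.

Lemma acoef_shift x y w i j : acoef (shift x w) y i j = acoef w (x + y) i j.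
Proof. by []. Qed.

(** This exhibits the operator as the generator of the walk: each second difference is the sum of
    the gradients along the two opposite steps, which have equal weights. *)
Lemma LopE w u x : Lop w u x = \sum_(e <- steps) wt e (shift x w) * grad e u x.
Proof.
rewrite big_steps /Lop /mxtrace mulr_sumr; apply: eq_bigr => i _.
rewrite mxE (bigD1 i)//= [X in _ + X]big1 ?addr0; last first.
  by move=> j ji; rewrite [hess _ _ _ _]mxE (negbTE ji) mulr0.
rewrite [hess _ _ _ _]mxE mxE eqxx mulr1n wtN wt_unit acoef_shift addr0 /grad.
by rewrite !mxE; field; rewrite gt_eqF ?tr_gt0.
Qed.

Lemma fluxE (phi : Env -> Zd -> R) j x w :
  flux phi j x w = 2 * wt (unit_vec j) (shift x w) *
    (grad (unit_vec j) (phi w) x - grad (- unit_vec j) (phi w) x).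
Proof. by rewrite /flux wt_unit acoef_shift addr0 /grad; field. Qed.

End Steps.

(** * The environment seen from the walker *)

Section MeasurePreserving.
Context {dT} {T : measurableType dT} {R : realType} (mu : probability T R) (S : T -> T).
Hypotheses (mS : measurable_fun setT S)
  (muS : forall A, measurable A -> mu (S @^-1` A) = mu A).

Lemma ae_preserving (A : T -> Prop) :
  {ae mu, forall t, A t} -> {ae mu, forall t, A (S t)}.
Proof.
move=> [N [mN N0 AN]]; exists (S @^-1` N); split.
- by rewrite -[X in measurable X]setTI; exact: mS.
- by rewrite -N0; exact: muS.
- by move=> t At; exact: AN.
Qed.

Lemma integrable_preserving (f : T -> R) :
  mu.-integrable setT (EFin \o f) -> mu.-integrable setT (EFin \o (f \o S)).
Proof.
move=> /integrableP[mf foo]; apply/integrableP; split.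
  exact: (measurableT_comp (f := EFin \o f)).
move: foo; congr (_ < _)%E.
rewrite -[RHS](@ge0_integral_pushforward _ _ _ _ _ _ mS mu setT (fun x => `|(f x)%:E|%E))//.
  by apply: eq_measure_integral => A mA _; rewrite /= -muS.
exact: measurableT_comp.
Qed.

Lemma Rintegral_preserving (f : T -> R) : mu.-integrable setT (EFin \o f) ->
  \int[mu]_t f (S t) = \int[mu]_t f t.
Proof.
move=> intf; congr fine.
rewrite -[LHS](@integral_pushforward _ _ _ _ _ _ mS mu setT (fun x => (f x)%:E))//.
- by apply: eq_measure_integral => A mA _; exact: muS.
- exact: (measurable_int _ intf).
- exact: integrable_preserving.
Qed.

End MeasurePreserving.

(** * First step of the walk, one-step invariance and ergodicity *)

Section Walk.
Context {R : realType} {d : nat}.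
Local Notation Zd := (lattice d).
Local Notation Env := (env R d).
Hypothesis d_gt0 : (0 < d)%N.
Variables (Pw : R.-pker Env ~> path_space d) (hPw : quenched_law Pw).
Variables (Q : probability Env R).

Lemma measurable_path (n : nat) (A : set Zd) :
  measurable [set X : path_space d | A (X n)].
Proof. by apply: sub_sigma_algebra; exists n, A. Qed.

Lemma prob_ker w : Pw w setT = 1%E.
Proof. exact: prob_kernel. Qed.

Lemma ker_full w (E F : set (path_space d)) : measurable E -> measurable F ->
  Pw w F = 1%E -> Pw w E = Pw w (E `&` F).
Proof.
move=> mE mF F1; have F0 : Pw w (setT `\` F) = 0%E.
  have : (Pw w setT = Pw w (setT `\` F) + Pw w (setT `&` F))%E by exact: measureDI.
  rewrite setTI F1 prob_ker => e.
  by rewrite -(@addeK _ 1%E (Pw w _))// -e subee.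
have -> : (Pw w E = Pw w (E `\` F) + Pw w (E `&` F))%E by exact: measureDI.
rewrite (subset_measure0 (B := setT `\` F)) ?add0e//.
- exact: measurableD.
- exact: measurableD.
- by move=> X [].
Qed.

Lemma walk_start w : Pw w [set X : path_space d | X 0%N = 0] = 1%E.
Proof.
have := hPw w 0 (fun=> 0); rewrite big_ord0 eqxx mulr1 => <-.
congr (Pw w _); rewrite eqEsubset; split => X /= h; last exact: h.
by case.
Qed.

Lemma walk_step w e :
  Pw w [set X : path_space d | X 0%N = 0 /\ X 1%N = e] = (wt e w)%:E.
Proof.
have := hPw w 1 (fun n => if n is 0 then 0 else e).
rewrite big_ord1 eqxx mul1r => <-.
congr (Pw w _); rewrite eqEsubset; split => X /=.
  by move=> [X0 X1] [|[|]].
by move=> h; split; exact: h.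
Qed.

(** Confining the first step to a finite list makes the event a finite disjoint union of two-point
    cylinders, whose probabilities [quenched_law] prescribes. *)
Let walk_steps w (s : seq Zd) (A : set Zd) : uniq s ->
  Pw w [set X : path_space d | X 0%N = 0 /\ (X 1%N \in s /\ A (X 1%N))] =
  (\sum_(e <- s) wt e w * \1_A e)%:E.
Proof.
elim: s => [|e s ih].
  rewrite big_nil => _; rewrite -[RHS](measure0 (Pw w)); congr (Pw w _).
  by rewrite -subset0 => X /= [_ []].
move=> /= /andP[es us]; rewrite big_cons EFinD -ih//.
have -> : (wt e w * \1_A e)%:E =
    Pw w ([set X : path_space d | X 0%N = 0] `&` [set X | (X 1%N = e) /\ A (X 1%N)]).
  rewrite indicE; case: (boolP (e \in A)) => eA; rewrite ?mulr1 ?mulr0.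
    rewrite -walk_step; congr (Pw w _); rewrite eqEsubset; split => X /=.
      by move=> [? e1]; split => //; split => //; rewrite e1; exact/set_mem.
    by case=> ? [].
  rewrite [RHS](_ : _ = Pw w set0); first by rewrite measure0.
  congr (Pw w _).
  rewrite -subset0 => X /= [_ [e1]]; rewrite e1 => /mem_set.
  exact/negP.
rewrite -measureU.
- congr (Pw w _); rewrite eqEsubset; split => X /=.
    rewrite inE; move=> [-> [/predU1P[->|->] Ae]]; [by left|by right].
  by move=> [[-> [-> Ae]]|[-> [X1 Ae]]]; rewrite inE ?eqxx ?X1 ?orbT.
- by apply: measurableI; [exact: (measurable_path 0 [set 0])|
    exact: (measurable_path 1 [set x | x = e /\ A x])].
- apply: measurableI; [exact: (measurable_path 0 [set 0])|].
  exact: (measurable_path 1 [set x | x \in s /\ A x]).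
- rewrite -subset0 => X /= [[_ [-> _]] [_ [e's _]]].
  by move: es; rewrite e's.
Qed.

(** Since the weights sum to one, starting at the origin and stepping within [steps] is an event of
    full probability, and intersecting with it changes nothing. *)
Lemma walk_first_step w (A : set Zd) :
  Pw w [set X : path_space d | A (X 1%N)] = (\sum_(e <- steps) wt e w * \1_A e)%:E.
Proof.
rewrite -walk_steps; last exact: steps_uniq.
set F := [set X : path_space d | X 0%N = 0 /\ (X 1%N \in steps /\ setT (X 1%N))].
have mF : measurable F.
  apply: measurableI; first exact: (measurable_path 0 [set 0]).
  exact: (measurable_path 1 [set x | x \in steps /\ setT x]).
have F1 : Pw w F = 1%E.
  rewrite walk_steps ?steps_uniq//; congr EFin.
  rewrite -[RHS](sum_wt d_gt0 w); apply: eq_bigr => e _.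
  by rewrite indicE in_setT mulr1.
rewrite (ker_full (measurable_path 1 A) mF F1); congr (Pw w _).
rewrite eqEsubset; split => X /=.
  by move=> [AX [X0 [X1 _]]].
by move=> [X0 [X1 AX]].
Qed.

Hypothesis statQ : env_stationary Q Pw.

Lemma measurable_shift x : measurable_fun setT (shift x : Env -> Env).
Proof. exact: measurable_relabel. Qed.

(** Stationarity is applied to an event that depends on time 0 only: its time shift looks at time 1,
    where the law of the first step gives the right-hand side. *)
Lemma one_step_invariance (A : set Env) : measurable A ->
  Q A = (\int[Q]_w (\sum_(e <- steps) wt e w * \1_A (shift e w))%:E)%E.
Proof.
move=> mA.
have mB : measurable ([set s | A (s 0%N)] : set (env_seq R d)).
  by apply: sub_sigma_algebra; exists 0%N, A.
have := statQ mB; rewrite /env_seq_law /annealed /env_from_walker/=.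
under eq_integral => w _.
  rewrite [X in Pw w X](_ : _ = [set X : path_space d | [set x | A (shift x w)] (X 1%N)])//.
  rewrite walk_first_step; over.
move=> ->.
under eq_integral => w _.
  rewrite [Pw w _](_ : _ = (\1_A w)%:E); first over.
  have s0 : shift 0 w = w by apply/funext => x; rewrite /shift add0r.
  have mS := measurable_path 0 [set 0].
  rewrite (ker_full (measurable_path 0 [set x | A (shift x w)]) mS (walk_start w)).
  rewrite indicE; case: (boolP (w \in A)) => wA.
    rewrite -(walk_start w); congr (Pw w _); rewrite eqEsubset; split => X /=; first by case.
    by move=> X0; split => //; rewrite X0 s0; exact/set_mem.
  rewrite [LHS](_ : _ = Pw w set0); first by rewrite measure0.
  congr (Pw w _).
  rewrite -subset0 => X /= [+ X0]; rewrite X0 s0 => /mem_set.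
  exact/negP.
by rewrite integral_indic// setIT.
Qed.

Hypothesis ergQ : env_ergodic Q Pw.

Lemma shift_invariant01 (A : set Env) : measurable A ->
  (forall x w, A (shift x w) = A w) -> Q A = 0%E \/ Q A = 1%E.
Proof.
move=> mA hA.
(* Ergodicity concerns sets exactly equal to their preimage under the time shift. Being eventually
   in [A] is such a set, and along a walk it occurs surely or never, according to whether [w] is in
   [A]. *)
pose B : set (env_seq R d) := [set s | exists N : nat, forall n : nat, (if (N <= n)%N then [set s : env_seq R d | A (s n)] else setT) s].
have BE s : B s <-> exists N : nat, forall n, (N <= n)%N -> A (s n).
  split=> -[N h]; exists N => n; first by move=> Nn; have := h n; rewrite Nn.
  by have := h n; case: ifP => // Nn; exact.
have mB : measurable B.
  apply: measurable_exists_countable => N; apply: measurable_forall_countable => n.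
  by case: ifP => // _; apply: sub_sigma_algebra; exists n, A.
have iB : @time_shift R d @^-1` B = B.
  apply/seteqP; split => s /BE[N h]; apply/BE.
    by exists N.+1 => -[//|n] Nn; exact: h.
  by exists N => n Nn; apply: h; rewrite (leq_trans Nn).
suff <- : env_seq_law Q Pw B = Q A by exact: ergQ.
rewrite /env_seq_law /annealed.
under eq_integral => w _.
  rewrite [Pw w _](_ : _ = (\1_A w)%:E); first over.
  rewrite indicE; case: (boolP (w \in A)) => wA.
    rewrite -(prob_ker w); congr (Pw w _); apply/seteqP; split => X //= _.
    apply/BE; exists 0%N => n _; rewrite /env_from_walker/= hA; exact/set_mem.
  rewrite [LHS](_ : _ = Pw w set0); first by rewrite measure0.
  congr (Pw w _).
  rewrite -subset0 => X /= /BE[N /(_ N (leqnn N))].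
  by rewrite /env_from_walker/= hA => /mem_set; exact/negP.
by rewrite integral_indic// setIT.
Qed.

End Walk.

(** * Integrals of real functions and change of density *)

Section RealIntegral.
Context {dT} {T : measurableType dT} {R : realType} (mu : probability T R).
Implicit Types f g : T -> R.

Definition intR f := mu.-integrable setT (EFin \o f).

Lemma intR_measurable f : intR f -> measurable_fun setT f.
Proof. by move=> /integrableP[mf _]; exact/measurable_EFinP. Qed.

Lemma intR_le f g : measurable_fun setT f -> intR g -> (forall t, `|f t| <= g t) -> intR f.
Proof.
move=> mf ig fg; apply: (le_integrable measurableT _ _ ig); first exact/measurable_EFinP.
by move=> t _ /=; rewrite lee_fin (le_trans (fg t))// ler_norm.
Qed.

Lemma intRD f g : intR f -> intR g -> intR (fun t => f t + g t).
Proof.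
by move=> fi gi; apply: eq_integrable (integrableD measurableT fi gi).
Qed.

Lemma intRZ c f : intR f -> intR (fun t => c * f t).
Proof. by move=> fi; apply: eq_integrable (integrableZl measurableT c fi). Qed.

Lemma intRN f : intR f -> intR (fun t => - f t).
Proof. by move=> fi; apply: eq_integrable (integrableN fi). Qed.

Lemma intRB f g : intR f -> intR g -> intR (fun t => f t - g t).
Proof. by move=> fi /intRN; exact: intRD. Qed.

Lemma intR_norm f : intR f -> intR (fun t => `|f t|).
Proof. exact: integrable_norm. Qed.

Lemma intR_cst c : intR (fun=> c).
Proof. exact: finite_measure_integrable_cst. Qed.

Lemma intR_sum (I : eqType) (s : seq I) (F : I -> T -> R) :
  (forall i, i \in s -> intR (F i)) -> intR (fun t => \sum_(i <- s) F i t).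
Proof.
elim: s => [_|i s ih hF].
  by under eq_fun do rewrite big_nil; exact: intR_cst.
under eq_fun do rewrite big_cons; apply: intRD; first by apply: hF; rewrite inE eqxx.
by apply: ih => j js; apply: hF; rewrite inE js orbT.
Qed.

Lemma Rintegral_sum (I : eqType) (s : seq I) (F : I -> T -> R) :
  (forall i, i \in s -> intR (F i)) ->
  \int[mu]_t (\sum_(i <- s) F i t) = \sum_(i <- s) \int[mu]_t F i t.
Proof.
elim: s => [_|i s ih hF].
  under eq_Rintegral do rewrite big_nil.
  by rewrite Rintegral_cst// mul0r big_nil.
have hs j : j \in s -> intR (F j) by move=> js; apply: hF; rewrite inE js orbT.
under eq_Rintegral do rewrite big_cons.
rewrite RintegralD//; first by rewrite big_cons ih.
- by apply: hF; rewrite inE eqxx.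
- exact: (intR_sum hs).
Qed.

Lemma ae_Rintegral f g : measurable_fun setT f -> measurable_fun setT g ->
  {ae mu, forall t, f t = g t} -> \int[mu]_t f t = \int[mu]_t g t.
Proof.
move=> mf mg fg; congr fine; apply: ae_eq_integral => //.
- exact/measurable_EFinP.
- exact/measurable_EFinP.
- by apply: filterS fg => t /= -> _.
Qed.

Lemma Rintegral_eq0_ae f : intR f -> {ae mu, forall t, 0 <= f t} ->
  \int[mu]_t f t = 0 -> {ae mu, forall t, f t = 0}.
Proof.
move=> fi f0 If.
have mf := intR_measurable fi.
have : \int[mu]_t `|f t| = 0.
  rewrite -If; apply: ae_Rintegral => //; first exact: measurableT_comp.
  by apply: filterS f0 => t /ger0_norm.
have fin : (\int[mu]_t `|f t|%:E)%E \is a fin_num.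
  exact: integrable_fin_num (intR_norm fi).
move=> I0; have {}I0 : (\int[mu]_t `|(f t)%:E| = 0)%E.
  by rewrite /=; rewrite -[LHS]fineK//; congr EFin.
have /(ae_eq_integral_abs mu measurableT) : measurable_fun setT (EFin \o f).
  exact/measurable_EFinP.
move=> [/(_ I0) + _]; apply: filterS => t /(_ Logic.I)/=.
by case.
Qed.

Lemma ae_eq_of_indic f g : intR f -> intR g ->
  (forall A, measurable A -> \int[mu]_t (\1_A t * f t) = \int[mu]_t (\1_A t * g t)) ->
  {ae mu, forall t, f t = g t}.
Proof.
move=> fi gi fg.
have H h A : intR h -> measurable A -> (\int[mu]_(t in A) (h t)%:E = (\int[mu]_t (\1_A t * h t))%:E)%E.
  move=> hi mA; rewrite integral_mkcond.
  have E t : ((EFin \o h) \_ A) t = (\1_A t * h t)%:E.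
    rewrite patchE indicE; case: ifP => _ /=; first by rewrite mul1r.
    by rewrite mul0r.
  rewrite (eq_integral (fun t => (\1_A t * h t)%:E)); last by move=> t _; rewrite -E.
  rewrite fineK//; apply: integrable_fin_num => //.
  apply: (@intR_le (fun t => \1_A t * h t) (fun t => `|h t|)).
  - by apply: measurable_funM; [exact: measurable_indic|exact: intR_measurable].
  - exact: intR_norm.
  - move=> t; rewrite normrM ler_piMl// indicE.
    by case: (t \in A); rewrite ?normr1 ?normr0.
have := @integral_ae_eq _ T R mu setT measurableT (EFin \o g) (EFin \o f) fi (measurable_int _ gi).
have h : forall E, E `<=` setT -> measurable E ->
    (\int[mu]_(x in E) (EFin \o f) x = \int[mu]_(x in E) (EFin \o g) x)%E.
  by move=> E _ mE; rewrite !H// fg.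
by move=> /(_ h); apply: filterS => t /(_ Logic.I)/= [].
Qed.

End RealIntegral.

Section Density.
Context {R : realType} {d : nat}.
Local Notation Env := (env R d).
Variables (P Q : probability Env R) (rho : Env -> R).
Hypotheses (QP : Q `<< P) (hrho : density P Q rho).

Lemma intR_density : intR P rho.
Proof.
have [mr r0 rE] := hrho; apply/integrableP; split; first exact/measurable_EFinP.
under eq_integral do rewrite /= ger0_norm//.
rewrite -rE//; apply: (@le_lt_trans _ _ 1%E); last exact: ltry.
exact: probability_le1.
Qed.

(** [density] speaks of sets only. Integrating over sets identifies [rho] almost everywhere with the
    Radon-Nikodym derivative, for which the change of variables holds for functions. *)
Lemma Rintegral_density (g : Env -> R) : measurable_fun setT g -> (forall w, 0 <= g w <= 1) ->
  \int[Q]_w g w = \int[P]_w (rho w * g w).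
Proof.
move=> mg g01; have [mr r0 rE] := hrho.
have gi : Q.-integrable setT (EFin \o g).
  apply: (@intR_le _ _ _ Q g (fun=> 1)) => //; first exact: intR_cst.
  by move=> w; have /andP[? ?] := g01 w; rewrite ger0_norm.
have QP' : charge_of_finite_measure Q `<< P by exact: QP.
have RN : ae_eq P setT (Radon_Nikodym (charge_of_finite_measure Q) P) (EFin \o rho).
  apply: integral_ae_eq => //.
  - exact: Radon_Nikodym_integrable.
  - exact/measurable_EFinP.
  - by move=> E _ mE; rewrite -Radon_Nikodym_integral// -rE.
congr fine; rewrite -(Radon_Nikodym_change_of_variables QP' measurableT gi).
apply: ae_eq_integral => //.
- apply: emeasurable_funM; first exact/measurable_EFinP.
  exact: measurable_int (Radon_Nikodym_integrable _).
- by apply/measurable_EFinP; exact: measurable_funM.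
- by apply: filterS RN => w /= h /h ->; rewrite -EFinM mulrC.
Qed.

End Density.

(** * Uniqueness and mirror symmetry of the invariant density *)

Section InvariantDensity.
Context {R : realType} {d : nat}.
Local Notation Zd := (lattice d).
Local Notation Env := (env R d).
Hypothesis d_gt0 : (0 < d)%N.
Variables (P : probability Env R) (iidP : iid P).
Implicit Types (f g : Env -> R) (w : Env) (x e : Zd).

Lemma env_shift0 w : shift 0 w = w.
Proof. by apply/funext => x; rewrite /shift add0r. Qed.

Lemma env_shiftD x y w : shift x (shift y w) = shift (y + x) w.
Proof. by apply/funext => z; rewrite /shift addrA. Qed.

Lemma shift_inv x (A : set Env) : measurable A -> P (shift x @^-1` A) = P A.
Proof. by apply: (iid_relabel iidP (tau := fun y => x + y)); exact: addrI. Qed.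

Lemma ae_shift (A : Env -> Prop) x :
  {ae P, forall w, A w} -> {ae P, forall w, A (shift x w)}.
Proof. by apply: ae_preserving; [exact: measurable_shift|exact: shift_inv]. Qed.

Lemma ae_forall_shift (A : Env -> Prop) :
  {ae P, forall w, A w} -> {ae P, forall w, forall x, A (shift x w)}.
Proof. by move=> hA; apply: ae_forall_countable => x; exact: ae_shift. Qed.

Lemma intR_shift f x : intR P f -> intR P (fun w => f (shift x w)).
Proof. by apply: integrable_preserving; [exact: measurable_shift|exact: shift_inv]. Qed.

Lemma Rintegral_shift f x : intR P f -> \int[P]_w f (shift x w) = \int[P]_w f w.
Proof. by apply: Rintegral_preserving; [exact: measurable_shift|exact: shift_inv]. Qed.

(** The adjoint, with respect to [P], of averaging over the next environment: the mass that reaches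
    the origin from its neighbours [- e] in one step. *)
Definition adj f w : R :=
  \sum_(e <- steps) wt e (shift (- e) w) * f (shift (- e) w).

Lemma intR_wt f e : e \in steps -> intR P f -> intR P (fun w => wt e w * f w).
Proof.
move=> es fi; apply: (@intR_le _ _ _ P _ (fun w => `|f w|)); last 2 first.
- exact: intR_norm.
- move=> w; rewrite normrM ler_piMl// gtr0_norm ?wt_gt0//.
  exact: wt_le1.
by apply: measurable_funM; [exact: measurable_wt|exact: intR_measurable fi].
Qed.

Lemma intR_adj f : intR P f -> intR P (adj f).
Proof.
move=> fi; apply: intR_sum => e es.
exact: (@intR_shift (fun w => wt e w * f w) (- e) (intR_wt es fi)).
Qed.

(** Mass is conserved: shift invariance brings every term back to the origin, where the weights sum
    to one. *)
Lemma Rintegral_adj f : intR P f -> \int[P]_w adj f w = \int[P]_w f w.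
Proof.
move=> fi; rewrite Rintegral_sum => [|e es]; last first.
  exact: (@intR_shift (fun w => wt e w * f w) (- e) (intR_wt es fi)).
rewrite big_seq; under eq_bigr => e es.
  rewrite (@Rintegral_shift (fun w => wt e w * f w) (- e) (intR_wt es fi)); over.
rewrite -big_seq -Rintegral_sum => [|e es]; last exact: intR_wt.
by apply: eq_Rintegral => w _; rewrite -mulr_suml sum_wt// mul1r.
Qed.

Lemma normr_adj f w : `|adj f w| <= adj (fun w => `|f w|) w.
Proof.
apply: (le_trans (ler_norm_sum _ _ _)); rewrite /adj !big_seq.
by apply: ler_sum => e es; rewrite normrM gtr0_norm ?wt_gt0.
Qed.

Lemma adjD f g w : adj (fun w => f w + g w) w = adj f w + adj g w.
Proof. by rewrite -big_split; apply: eq_bigr => e _; rewrite mulrDr. Qed.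

Lemma adjN f w : adj (fun w => - f w) w = - adj f w.
Proof. by rewrite -sumrN; apply: eq_bigr => e _; rewrite mulrN. Qed.

(** One-step invariance of [Q] is tested on indicators and written with [rho]; shifting the term of
    step [e] by [- e] frees the indicator, and comparing for all sets gives the pointwise
    equation. *)
Lemma density_adj (Q : probability Env R) (rho : Env -> R)
    (Pw : R.-pker Env ~> path_space d) : quenched_law Pw -> env_stationary Q Pw ->
  Q `<< P -> density P Q rho -> {ae P, forall w, rho w = adj rho w}.
Proof.
move=> hPw statQ QP hrho; have ri := intR_density hrho.
have mr := intR_measurable ri.
apply: ae_eq_of_indic => //; first exact: intR_adj.
move=> A mA.
have mI : measurable_fun setT (\1_A : Env -> R) by exact: measurable_indic.
have I01 w : 0 <= (\1_A w : R) <= 1 by rewrite indicE; case: (w \in A); rewrite ?ler01 ?lexx.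
have mIs e : measurable_fun setT (fun w : Env => \1_A (shift e w) : R).
  by apply: (measurableT_comp mI); exact: measurable_shift.
pose F e w : R := wt e w * rho w * \1_A (shift e w).
have Fi e : e \in steps -> intR P (F e).
  move=> es; apply: (@intR_le _ _ _ P _ (fun w => `|wt e w * rho w|)).
  - by apply: measurable_funM => //; apply: measurable_funM => //; exact: measurable_wt.
  - by apply: intR_norm; exact: intR_wt.
  - by move=> w; rewrite normrM ler_piMr// ger0_norm; have /andP[] := I01 (shift e w).
have -> : \int[P]_w (\1_A w * rho w) = fine (Q A).
  rewrite -(setIT A) -integral_indic// setIT.
  under eq_Rintegral do rewrite mulrC.
  by rewrite -(Rintegral_density QP hrho).
rewrite (one_step_invariance d_gt0 hPw statQ mA).
have -> : fine (\int[Q]_w (\sum_(e <- steps) wt e w * \1_A (shift e w))%:E)%E =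
    \int[Q]_w (\sum_(e <- steps) wt e w * \1_A (shift e w)) by [].
rewrite (Rintegral_density QP hrho); last 2 first.
- by apply: measurable_sum => e; apply: measurable_funM => //; exact: measurable_wt.
- move=> w; rewrite big_seq sumr_ge0/=.
    rewrite -(sum_wt d_gt0 w) [leRHS]big_seq; apply: ler_sum => e es.
    by rewrite ler_piMr ?(ltW (wt_gt0 _ _ _))//; have /andP[] := I01 (shift e w).
  by move=> e es; rewrite mulr_ge0 ?(ltW (wt_gt0 _ _ _))//; have /andP[] := I01 (shift e w).
transitivity (\int[P]_w (\sum_(e <- steps) F e w)).
  apply: eq_Rintegral => w _; rewrite mulr_sumr; apply: eq_bigr => e _.
  by rewrite /F; ring.
rewrite Rintegral_sum//.
have Gi e : e \in steps -> intR P (fun w => F e (shift (- e) w)).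
  by move=> es; apply: intR_shift; exact: Fi.
rewrite big_seq; under eq_bigr => e es.
  rewrite -(@Rintegral_shift _ (- e) (Fi e es)); over.
rewrite -big_seq -Rintegral_sum//.
apply: eq_Rintegral => w _; rewrite mulr_sumr; apply: eq_bigr => e _.
by rewrite /F env_shiftD addNr env_shift0; ring.
Qed.

Section Uniqueness.
Variables (Pw : R.-pker Env ~> path_space d) (Q : probability Env R).
Hypotheses (PQ : P `<< Q) (ergQ : env_ergodic Q Pw).

(** Where a nonnegative fixed point vanishes, so does every term of the sum defining [adj]; as the
    weights are positive, it vanishes at all neighbours, and then everywhere by connectedness. *)
Lemma adj_ge0_support g : (forall w, 0 <= g w) -> {ae P, forall w, g w = adj g w} ->
  {ae P, forall w, g w = 0 -> forall x, g (shift x w) = 0}.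
Proof.
move=> g0 /ae_forall_shift; apply: filterS => w hw gw0.
apply: lattice_ind; first by rewrite env_shift0.
move=> x e es gx.
have := hw x; rewrite gx /adj => /esym/eqP; rewrite big_seq psumr_eq0; last first.
  by move=> e' es'; rewrite mulr_ge0 ?g0// ltW// wt_gt0.
move=> /allP/(_ (- e)); rewrite stepsN opprK env_shiftD => /(_ es)/implyP/(_ es).
by rewrite mulf_eq0 gt_eqF ?wt_gt0 ?stepsN//= => /eqP.
Qed.

Lemma adj_fixed_eq0 f : intR P f -> {ae P, forall w, f w = adj f w} ->
  \int[P]_w f w = 0 -> {ae P, forall w, f w = 0}.
Proof.
move=> fi fadj If; have mf := intR_measurable fi.
pose a w : R := `|f w|.
have ai : intR P a by exact: intR_norm.
(* [adj a - a] is nonnegative by the triangle inequality and has mean zero by conservation of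
   mass. *)
have aadj : {ae P, forall w, adj a w - a w = 0}.
  apply: Rintegral_eq0_ae.
  - by apply: intRB => //; exact: intR_adj.
  - apply: filterS fadj => w fw; rewrite subr_ge0 /a {1}fw; exact: normr_adj.
  - by rewrite RintegralB ?Rintegral_adj ?subrr//; exact: intR_adj.
pose g w : R := a w + f w.
have g0 w : 0 <= g w by rewrite /g /a; have := ler_norm (- f w); rewrite normrN; lra.
have gadj : {ae P, forall w, g w = adj g w}.
  apply: filterS2 aadj fadj => w aw fw.
  by rewrite /g adjD -fw; congr (_ + _); apply/esym/eqP; rewrite -subr_eq0 aw.
have mg : measurable_fun setT g by apply: measurable_funD => //; exact: intR_measurable ai.
(* Asking for zeros along the whole orbit makes the event exactly shift invariant; by
   [adj_ge0_support] it differs from the zero set of [g] by a null set only. *)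
pose A : set Env := [set w | forall x, g (shift x w) = 0].
have mA : measurable A.
  apply: measurable_forall_countable => x.
  have ms := @measurable_shift R d x.
  rewrite -[X in measurable X]setTI.
  have := measurableT_comp mg ms measurableT (measurable_set1 0).
  by [].
have sA x w : A (shift x w) = A w.
  apply/propext; split => h y.
    by have := h (y - x); rewrite env_shiftD addrC subrK.
  by rewrite env_shiftD.
have null B : measurable B -> Q B = 0%E -> {ae P, forall w, ~ B w}.
  move=> mB QB; exists B; split => //; last by move=> w /= /contrapT.
  by move/null_content_dominatesP : PQ => /(_ B mB QB).
(* If [A] is null then [g] is almost surely nonzero, which excludes [f w < 0]; so [f] is nonnegative
   with mean zero. *)
case: (shift_invariant01 ergQ mA sA) => [QA|QA].
  have nA := null _ mA QA.
  apply: Rintegral_eq0_ae => //.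
  apply: filterS2 nA (adj_ge0_support g0 gadj) => w nAw hw.
  rewrite leNgt; apply/negP => fw; apply: nAw => x; apply: hw.
  by rewrite /g /a ltr0_norm// addNr.
(* In the other case [g] vanishes almost surely, that is [f <= 0], and the same argument applies to
   [- f]. *)
have QAC : Q (~` A) = 0%E.
  by rewrite probability_setC// [X in (1 - X)%E](_ : _ = 1%E)// subee.
have nA := null _ (measurableC mA) QAC.
have fle : {ae P, forall w, 0 <= - f w}.
  apply: filterS nA => w /contrapT /(_ 0); rewrite env_shift0 /g /a => h.
  by have := normr_ge0 (f w); lra.
have IN : \int[P]_w (- f w) = 0.
  under eq_Rintegral do rewrite -mulN1r.
  by rewrite RintegralZl// If mulr0.
apply: filterS (Rintegral_eq0_ae (intRN fi) fle IN) => w /eqP.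
by rewrite oppr_eq0 => /eqP.
Qed.
End Uniqueness.

Lemma iid_mirror (A : set Env) : measurable A -> P (relabel -%R @^-1` A) = P A.
Proof. by apply: (iid_relabel iidP); exact: oppr_inj. Qed.

Lemma mirror_shift x w : relabel -%R (shift x w) = shift (- x) (relabel -%R w).
Proof. by apply/funext => y; rewrite /relabel /shift/= opprD opprK. Qed.

Lemma wt_mirror e w : wt e (relabel -%R w) = wt e w.
Proof. by rewrite /wt /trans /acoef /relabel/= oppr0. Qed.

(** The mirror map fixes the origin and exchanges the steps [e] and [- e], which carry the same
    weight. *)
Lemma adj_mirror f w : adj (fun w => f (relabel -%R w)) w = adj f (relabel -%R w).
Proof.
rewrite /adj -[RHS]big_stepsN; apply: eq_bigr => e _.
by rewrite wtN opprK mirror_shift opprK -(wt_mirror e (shift (- e) w)) mirror_shift opprK.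
Qed.

Lemma density_mirror (Q : probability Env R) (rho : Env -> R)
    (Pw : R.-pker Env ~> path_space d) : quenched_law Pw -> invariant_measure P Q Pw ->
  density P Q rho -> {ae P, forall w, rho (relabel -%R w) = rho w}.
Proof.
move=> hPw [QP PQ statQ ergQ] hrho.
have ri := intR_density hrho.
have radj := density_adj hPw statQ QP hrho.
have mM := @measurable_relabel R d -%R.
have si : intR P (fun w => rho (relabel -%R w)).
  exact: (integrable_preserving mM iid_mirror ri).
pose f w := rho (relabel -%R w) - rho w.
have fi : intR P f by exact: intRB.
have fadj : {ae P, forall w, f w = adj f w}.
  apply: filterS2 radj (ae_preserving mM iid_mirror radj) => w rw sw.
  by rewrite /f adjD adjN adj_mirror -sw -rw.
have If : \int[P]_w f w = 0.
  by rewrite RintegralB// (Rintegral_preserving mM iid_mirror ri) subrr.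
apply: filterS (adj_fixed_eq0 PQ ergQ fi fadj If) => w /eqP.
by rewrite subr_eq0 => /eqP.
Qed.

End InvariantDensity.

(** * The energy of a harmonic field with stationary gradient *)

Section Energy.
Context {R : realType} {d : nat}.
Local Notation Zd := (lattice d).
Local Notation Env := (env R d).
Hypothesis d_gt0 : (0 < d)%N.
Variables (P : probability Env R) (iidP : iid P).
Implicit Types (w : Env) (x e : Zd).
Variables (rho : Env -> R) (u : Env -> Zd -> R) (C : R).
Hypotheses (rho_m : measurable_fun setT rho) (rho_ge0 : forall w, 0 <= rho w)
  (rho_adj : {ae P, forall w, rho w = adj rho w}).
Hypotheses (u_m : forall x, measurable_fun setT (u ^~ x))
  (u_harmonic : {ae P, forall w, forall x, Lop w (u w) x = 0})
  (u_stat : {ae P, forall w, forall x e, unit_dir e ->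
    grad e (u w) x = grad e (u (shift x w)) 0})
  (u_int : forall x, intR P (fun w => rho (shift x w) * u w x ^+ 2))
  (u_le : forall x, \int[P]_w (rho (shift x w) * u w x ^+ 2) <= C * (1 + l1 x))
  (g_int : forall e x, e \in steps -> intR P (fun w => rho (shift x w) * grad e (u w) x ^+ 2))
  (g_le : forall e x, e \in steps -> \int[P]_w (rho (shift x w) * grad e (u w) x ^+ 2) <= C).

(** [r e x] is the mass flowing from [x] to [x + e]; [H], [K] and [E] are the pieces of
    [r e x w * u w (x + e) ^+ 2 = H + 2 K + E], obtained from [u(x + e) = u(x) + grad e u x]. *)
Let r e x w := wt e (shift x w) * rho (shift x w).
Let H e x w := r e x w * u w x ^+ 2.
Let K e x w := r e x w * u w x * grad e (u w) x.
Let E e x w := r e x w * grad e (u w) x ^+ 2.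
Let h e x := \int[P]_w H e x w.
Let k e x := \int[P]_w K e x w.
Let D := \sum_(e <- steps) \int[P]_w E e 0 w.

Let rm e x : measurable_fun setT (r e x).
Proof.
apply: measurable_funM.
  exact: measurableT_comp (measurable_wt d_gt0 e) (@measurable_shift R d x).
exact: measurableT_comp rho_m (@measurable_shift R d x).
Qed.

Let gm e x : measurable_fun setT (fun w => grad e (u w) x).
Proof. exact: measurable_funB. Qed.

Let r_ge0 e x w : e \in steps -> 0 <= r e x w.
Proof. by move=> es; rewrite mulr_ge0// ltW// wt_gt0. Qed.

Let rsq_ge0 e x w (a : R) : e \in steps -> 0 <= r e x w * a ^+ 2.
Proof. by move=> es; rewrite mulr_ge0 ?sqr_ge0// r_ge0. Qed.

Let r_le e x w : e \in steps -> r e x w <= rho (shift x w).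
Proof. by move=> es; rewrite ler_piMl// wt_le1. Qed.

Let Hi e x : e \in steps -> intR P (H e x).
Proof.
move=> es; apply: (intR_le _ (u_int x)).
  by apply: measurable_funM => //; exact: measurable_funX.
by move=> w; rewrite /H ger0_norm ?rsq_ge0// ler_wpM2r ?sqr_ge0 ?r_le.
Qed.

Let Ei e x : e \in steps -> intR P (E e x).
Proof.
move=> es; apply: (intR_le _ (g_int x es)).
  by apply: measurable_funM => //; exact: measurable_funX.
by move=> w; rewrite /E ger0_norm ?rsq_ge0// ler_wpM2r ?sqr_ge0 ?r_le.
Qed.

(* AM-GM: [2 a b <= eps a^2 + b^2 / eps] *)
Let K_le e x w eps : e \in steps -> 0 < eps ->
  `|2 * K e x w| <= eps * (rho (shift x w) * u w x ^+ 2) +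
                    eps^-1 * (rho (shift x w) * grad e (u w) x ^+ 2).
Proof.
move=> es e0; rewrite /K; set a := u w x; set b := grad _ _ _; set s := rho _.
have s0 : 0 <= s := rho_ge0 _.
apply: (@le_trans _ _ (s * `|2 * a * b|)).
  rewrite [2 * _](_ : _ = r e x w * (2 * a * b)); last by ring.
  by rewrite normrM ler_wpM2r// ger0_norm ?r_ge0 ?r_le.
rewrite mulrCA [eps^-1 * _]mulrCA -mulrDr ler_wpM2l//.
have ei : 0 < eps^-1 by rewrite invr_gt0.
have e1 : eps * eps^-1 = 1 by rewrite mulfV ?gt_eqF.
have h1 : 0 <= eps^-1 * (eps * a - b) ^+ 2 by rewrite mulr_ge0 ?sqr_ge0// ltW.
have h2 : 0 <= eps^-1 * (eps * a + b) ^+ 2 by rewrite mulr_ge0 ?sqr_ge0// ltW.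
have h3 : eps^-1 * (eps * a - b) ^+ 2 = (eps * eps^-1) * (eps * a ^+ 2) - (eps * eps^-1) * (2 * a * b) + eps^-1 * b ^+ 2 by ring.
have h4 : eps^-1 * (eps * a + b) ^+ 2 = (eps * eps^-1) * (eps * a ^+ 2) + (eps * eps^-1) * (2 * a * b) + eps^-1 * b ^+ 2 by ring.
rewrite h3 e1 in h1; rewrite h4 e1 in h2.
by rewrite ler_norml; apply/andP; split; lra.
Qed.

Let Ki e x : e \in steps -> intR P (K e x).
Proof.
move=> es; apply: (@intR_le _ _ _ P _ (fun w => rho (shift x w) * u w x ^+ 2 + rho (shift x w) * grad e (u w) x ^+ 2)).
- by apply: measurable_funM => //; exact: measurable_funM.
- by apply: intRD => //; exact: g_int.
move=> w; have := K_le x w es ltr01; rewrite invr1 !mul1r; apply: le_trans.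
by rewrite [leRHS]normrM ler_peMl// ger0_norm ?ler1n.
Qed.

(** The mass entering [x] is [rho] there, so [rho u^2] at [x] is the sum of the flows from [x - e]
    times [u(x)^2], expanded around [x - e]. It is also the sum of the [H e x], and harmonicity
    makes the sum of the [K e x] vanish. *)
Let identity x : {ae P, forall w,
  \sum_(e <- steps) (H e (x - e) w - H e x w) +
  2 * \sum_(e <- steps) (K e (x - e) w - K e x w) +
  \sum_(e <- steps) E e (x - e) w = 0}.
Proof.
apply: filterS2 (ae_shift iidP x rho_adj) u_harmonic => w hr /(_ x).
rewrite LopE// => hu.
have hK : \sum_(e <- steps) K e x w = 0.
  transitivity (rho (shift x w) * u w x * \sum_(e <- steps) wt e (shift x w) * grad e (u w) x); last by rewrite hu mulr0.
  by rewrite mulr_sumr; apply: eq_bigr => e _; rewrite /K /r; ring.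
have hH : \sum_(e <- steps) H e x w = rho (shift x w) * u w x ^+ 2.
  by rewrite -mulr_suml -mulr_suml sum_wt// mul1r.
rewrite [in X in _ + 2 * X + _]sumrB hK subr0 sumrB hH mulr_sumr.
have -> : rho (shift x w) * u w x ^+ 2 = \sum_(e <- steps) r e (x - e) w * u w x ^+ 2.
  by rewrite -mulr_suml hr; congr (_ * _); apply: eq_bigr => e _; rewrite /r !env_shiftD.
rewrite -sumrB -!big_split big1//= => e _.
by rewrite /H /K /E /grad subrK; ring.
Qed.

(** The energy density is stationary, so its mean is the constant to which the divergence argument
    applies. *)
Let E_shift e x : e \in steps -> \int[P]_w E e x w = \int[P]_w E e 0 w.
Proof.
move=> es; rewrite -[RHS](Rintegral_shift iidP x (Ei 0 es)).
apply: ae_Rintegral.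
- exact: intR_measurable (Ei x es).
- exact: intR_measurable (intR_shift iidP x (Ei 0 es)).
apply: filterS u_stat => w hw; rewrite /E /r env_shift0 (hw x e)//.
exact/stepsP.
Qed.

(** This is the mean of [identity]. Because [h (- e) = h e], the first differences of [h] pair up
    over [e] and [- e] into second differences, whence the factor one half. *)
Let mean_identity x :
  D = \sum_(e <- steps) grad e (grad (- e) (fun y => 2^-1 * h e y)) x +
      \sum_(e <- steps) grad (- e) (fun y => - 2 * k e y) x.
Proof.
have hN e : h (- e) =1 h e by move=> y; apply: eq_Rintegral => w _; rewrite /H /r wtN.
have -> : \sum_(e <- steps) grad e (grad (- e) (fun y => 2^-1 * h e y)) x =
    - \sum_(e <- steps) (h e (x - e) - h e x).
  have -> : \sum_(e <- steps) (h e (x - e) - h e x) =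
      2^-1 * (\sum_(e <- steps) (h e (x - e) - h e x) + \sum_(e <- steps) (h e (x + e) - h e x)).
    rewrite -[X in _ + X]big_stepsN.
    have -> : \sum_(e <- steps) (h (- e) (x - e) - h (- e) x) = \sum_(e <- steps) (h e (x - e) - h e x).
      by apply: eq_bigr => e _; rewrite !hN.
    by field.
  rewrite -big_split mulr_sumr -sumrN; apply: eq_bigr => e _.
  by rewrite /grad addrK /=; field.
have -> : \sum_(e <- steps) grad (- e) (fun y => - 2 * k e y) x =
    - (2 * \sum_(e <- steps) (k e (x - e) - k e x)).
  by rewrite mulr_sumr -sumrN; apply: eq_bigr => e _; rewrite /grad; ring.
have Hd e : e \in steps -> intR P (fun w => H e (x - e) w - H e x w).
  by move=> es; apply: intRB; exact: Hi.
have Kd e : e \in steps -> intR P (fun w => K e (x - e) w - K e x w).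
  by move=> es; apply: intRB; exact: Ki.
have Es e : e \in steps -> intR P (fun w => E e (x - e) w) by exact: Ei.
have Hs := intR_sum Hd; have Ks := intRZ 2 (intR_sum Kd); have Ess := intR_sum Es.
have I0 : \int[P]_w (\sum_(e <- steps) (H e (x - e) w - H e x w) +
  2 * \sum_(e <- steps) (K e (x - e) w - K e x w) +
  \sum_(e <- steps) E e (x - e) w) = 0.
  rewrite (ae_Rintegral _ _ (identity x)); last 2 first.
  - exact: intR_measurable (intRD (intRD Hs Ks) Ess).
  - exact: measurable_cst.
  by rewrite Rintegral_cst// mul0r.
move: I0; rewrite RintegralD//; last exact: intRD Hs Ks.
rewrite RintegralD// RintegralZl//; last exact: intR_sum Kd.
rewrite !Rintegral_sum//.
have -> : \sum_(e <- steps) \int[P]_w E e (x - e) w = D.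
  by rewrite /D big_seq [RHS]big_seq; apply: eq_bigr => e es; exact: E_shift.
have -> : \sum_(e <- steps) \int[P]_w (H e (x - e) w - H e x w) = \sum_(e <- steps) (h e (x - e) - h e x).
  by rewrite big_seq [RHS]big_seq; apply: eq_bigr => e es; rewrite RintegralB//; exact: Hi.
have -> : \sum_(e <- steps) \int[P]_w (K e (x - e) w - K e x w) = \sum_(e <- steps) (k e (x - e) - k e x).
  by rewrite big_seq [RHS]big_seq; apply: eq_bigr => e es; rewrite RintegralB//; exact: Ki.
lra.
Qed.

(** The moment bounds make [h] of linear growth, and AM-GM with a free [eps] bounds [k] in the form
    asked of [G]. A negative [C] would contradict [g_le], so then there are no steps and the sum is
    empty. *)
Let energy_eq0 : D = 0.
Proof.
have [C0|C0] := leP 0 C; last first.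
  rewrite /D big_seq big1// => e es; exfalso.
  have := g_le 0 es; have : 0 <= \int[P]_w (rho (shift 0 w) * grad e (u w) 0 ^+ 2).
    by apply: Rintegral_ge0 => w _; rewrite mulr_ge0 ?sqr_ge0.
  lra.
apply: (@sublinear_divergence_eq0 R d D C steps (fun e y => 2^-1 * h e y) (fun e y => - 2 * k e y)) => //.
- by move=> e es; split; [exact: l1_steps|rewrite stepsN|exact: steps_neqN].
- move=> e es x; have h0 : 0 <= h e x by apply: Rintegral_ge0 => w _; rewrite rsq_ge0.
  rewrite ger0_norm ?mulr_ge0 ?invr_ge0//.
  suff : h e x <= C * (1 + l1 x) by lra.
  apply: le_trans (u_le x); apply: le_Rintegral => //; [exact: Hi|exact: u_int|].
  by move=> w _; rewrite /H ler_wpM2r ?sqr_ge0 ?r_le.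
- move=> e es x eps e0.
  rewrite normrM normrN -normrM -RintegralZl//; last exact: Ki.
  apply: (le_trans (le_normr_Rintegral _ (intRZ 2 (Ki x es)))) => //.
  have i1 := intRZ eps (u_int x); have i2 := intRZ eps^-1 (g_int x es).
  apply: (le_trans (le_Rintegral measurableT (intR_norm (intRZ 2 (Ki x es))) (intRD i1 i2) _)).
    by move=> w _; exact: K_le.
  rewrite RintegralD// !RintegralZl//; [|exact: g_int|exact: u_int].
  have := ler_wpM2l (ltW e0) (u_le x).
  have ei : 0 <= eps^-1 by rewrite invr_ge0 ltW.
  have := ler_wpM2l ei (g_le x es).
  lra.
Qed.

(* Only [rho * grad u] is shown to vanish, which spares the positivity of [rho]. *)
Lemma harmonic_grad_eq0 e x : e \in steps ->
  {ae P, forall w, rho (shift x w) * grad e (u w) x = 0}.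
Proof.
move=> es.
have E0 : \int[P]_w E e 0 w = 0.
  have := energy_eq0; rewrite /D big_seq => /eqP; rewrite psumr_eq0.
    by move=> /allP/(_ _ es)/implyP/(_ es)/eqP.
  by move=> e' es'; apply: Rintegral_ge0 => w _; rewrite rsq_ge0.
have : {ae P, forall w, E e x w = 0}.
  apply: Rintegral_eq0_ae; [exact: Ei| |by rewrite E_shift].
  by apply: aeW => w; rewrite rsq_ge0.
apply: filterS => w /eqP; rewrite /E /r -mulrA mulf_eq0 gt_eqF ?wt_gt0//= !mulf_eq0 orbb.
by case/orP => /eqP ->; rewrite ?mul0r ?mulr0.
Qed.

End Energy.

(** * Moments and growth *)

Section Moments.
Context {R : realType}.

(** One Taylor term of the exponential, of high enough degree, dominates the fourth power; stretched
    exponential moments thus yield fourth moments. *)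
Lemma pow4_le_expR (q c : R) : 0 < q -> 0 < c ->
  exists2 M, 0 <= M & forall t, 0 <= t -> t ^+ 4 <= M * expR (c * t `^ q).
Proof.
(* With this [n], [q (n + 1) >= 4], hence [t^4 <= (t^q)^(n+1)] for [t >= 1]. *)
move=> q0 c0; pose n := Num.truncn (4 / q).
have qn : 4 <= q * n.+1%:R.
  by rewrite mulrC -ler_pdivrMr// ltW// truncnS_gt.
have cn0 : 0 < c ^- n.+1 by rewrite invr_gt0 exprn_gt0.
(* The summand [1] takes care of [t <= 1]; the other is the inverse of the Taylor coefficient of
   degree [n + 1]. *)
exists (1 + c ^- n.+1 * n.+1`!%:R); first by rewrite addr_ge0// mulr_ge0// ltW.
move=> t t0; have ct0 : 0 <= c * t `^ q by rewrite mulr_ge0 ?powR_ge0// ltW.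
have e0 : 0 <= expR (c * t `^ q) by exact: expR_ge0.
have f0 : 0 < n.+1`!%:R :> R by rewrite ltr0n fact_gt0.
have ex := expR_ge1Dxn n ct0.
have [t1|t1] := leP t 1.
  rewrite mulrDl mul1r (le_trans (_ : _ <= 1))//; first by rewrite exprn_ile1.
  apply: (@le_trans _ _ (expR (c * t `^ q))).
    by rewrite (le_trans _ ex)// lerDl divr_ge0// exprn_ge0.
  by rewrite lerDl !mulr_ge0// ltW.
have : t ^+ 4 <= (t `^ q) ^+ n.+1.
  have -> : t ^+ 4 = t `^ 4%:R by rewrite powR_mulrn.
  have -> : (t `^ q) ^+ n.+1 = (t `^ q) `^ n.+1%:R by rewrite powR_mulrn// powR_ge0.
  by rewrite -powRrM; apply: ler_powR => //; exact: ltW.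
move=> /le_trans; apply.
have -> : (t `^ q) ^+ n.+1 = c ^- n.+1 * n.+1`!%:R * ((c * t `^ q) ^+ n.+1 / n.+1`!%:R).
  rewrite exprMn; field.
  by rewrite (gt_eqF f0) expf_neq0// gt_eqF.
rewrite mulrDl mul1r -[leLHS]add0r lerD//.
rewrite ler_pM2l ?mulr_gt0//; lra.
Qed.

Context {dT} {T : measurableType dT} (mu : probability T R).

Lemma intR_of_le_expectation (f g : T -> R) (C : R) : measurable_fun setT f ->
  measurable_fun setT g -> (forall t, 0 <= f t <= g t) -> ('E_mu[g] <= C%:E)%E ->
  intR mu f /\ \int[mu]_t f t <= C.
Proof.
move=> mf mg fg; rewrite unlock => gC.
have f0 t : 0 <= f t by case/andP: (fg t).
have I : (\int[mu]_t (f t)%:E <= C%:E)%E.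
  apply: le_trans gC; apply: ge0_le_integral => //.
  - by move=> t _; rewrite lee_fin.
  - exact/measurable_EFinP.
  - exact/measurable_EFinP.
  - by move=> t _; rewrite lee_fin; case/andP: (fg t).
have fi : intR mu f.
  apply/integrableP; split; first exact/measurable_EFinP.
  under eq_integral do rewrite /= ger0_norm//.
  exact: le_lt_trans I (ltry _).
split=> //; rewrite -lee_fin fineK//.
exact: integrable_fin_num.
Qed.

Lemma int4_of_expectation (f : T -> R) (q c C M : R) : measurable_fun setT f ->
  0 <= M ->
  (forall t, 0 <= t -> t ^+ 4 <= M * expR (c * t `^ q)) ->
  ('E_mu[fun w => expR (c * `|f w| `^ q)] <= C%:E)%E ->
  intR mu (fun w => f w ^+ 4) /\ \int[mu]_w f w ^+ 4 <= M * C.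
Proof.
move=> mf M0 hM hC.
have mg : measurable_fun setT (fun w => expR (c * `|f w| `^ q)).
  apply: measurableT_comp => //; apply: measurable_funM => //.
  apply: (measurableT_comp (f := fun r : R => r `^ q)) => //.
  exact: measurableT_comp.
apply: (@intR_of_le_expectation (fun w => f w ^+ 4)
    (fun w => M * expR (c * `|f w| `^ q)) (M * C)).
- exact: measurable_funX.
- exact: measurable_funM.
- move=> t; rewrite exprn_even_ge0//=.
  by have := hM _ (normr_ge0 (f t)); rewrite -normrX ger0_norm// exprn_even_ge0.
- move: hC; rewrite unlock => hC.
  under eq_integral do rewrite EFinM.
  rewrite ge0_integralZl//; last first.
    apply/measurable_EFinP; apply: measurableT_comp => //; apply: measurable_funM => //.
    apply: (measurableT_comp (f := fun r : R => r `^ q)) => //.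
    exact: measurableT_comp.
  by rewrite EFinM; apply: lee_wpmul2l.
Qed.

End Moments.

Section Growth.
Context {R : realType} {d : nat}.
Local Notation Zd := (lattice d).

Lemma enorm_le_l1 (x : Zd) : enorm R x <= l1 x.
Proof.
rewrite -(ger0_norm (l1_ge0 x)) -sqrtr_sqr ler_sqrt ?sqr_ge0//.
rewrite expr2 {1}/l1 mulr_suml; apply: ler_sum => i _.
rewrite -[leLHS]real_normK ?num_real// expr2 ler_wpM2l//.
by rewrite /l1 (bigD1 i)//= lerDl sumr_ge0.
Qed.

Lemma enorm_ge0 (x : Zd) : 0 <= enorm R x.
Proof. exact: sqrtr_ge0. Qed.

Lemma enorm_gt0 (x : Zd) : x != 0 -> 0 < enorm R x.
Proof.
move=> x0; rewrite sqrtr_gt0.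
have [i xi] : exists i, x 0 i != 0.
  apply/existsP; rewrite -[X in is_true X]negbK; apply/negP => /existsPn h.
  by move/negP: x0; apply; apply/eqP/rowP => i; rewrite mxE; apply/eqP/negPn/h.
rewrite (bigD1 i)//= ltr_pwDl//; first by rewrite exprn_even_gt0//= intr_eq0.
by apply: sumr_ge0 => j _; exact: sqr_ge0.
Qed.

(** A single bound for all dimensions, the one that makes second moments of a corrector grow at most
    linearly. *)
Lemma growth_sqr_le (r : R) : 0 <= r -> growth d r ^+ 2 <= 1 + r.
Proof.
move=> r0; rewrite /growth; case: ifP => _; first by rewrite sqr_sqrtr// lerDr.
case: ifP => _; last by rewrite expr1n lerDl.
rewrite sqr_sqrtr ?le_max ?ler01// ge_max lerDl r0/=.
(* At [r = 0] the logarithm takes its default value [0]. *)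
have [->|rn0] := eqVneq r 0; first by rewrite ln0// addr0.
have rp : 0 < r by rewrite lt_neqAle eq_sym rn0.
by rewrite (le_trans (ltW (ln_sublinear rp)))// lerDr.
Qed.

Lemma growth_neq0 (r : R) : 0 < r -> growth d r != 0.
Proof.
move=> r0; rewrite /growth; case: ifP => _; first by rewrite gt_eqF// sqrtr_gt0.
case: ifP => _; last exact: oner_neq0.
by rewrite gt_eqF// sqrtr_gt0 lt_max ltr01.
Qed.

End Growth.

(** * Correctors and their mirror images *)

Section Corrector.
Context {R : realType} {d : nat}.
Local Notation Zd := (lattice d).
Local Notation Env := (env R d).
Hypothesis d_gt0 : (0 < d)%N.
Variables (P Q : probability Env R) (iidP : iid P).
Implicit Types (w : Env) (x e : Zd).

Definition mirror_field (phi : Env -> Zd -> R) w x : R := phi (relabel -%R w) (- x).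

Lemma grad_mirror phi e w x :
  grad e (mirror_field phi w) x = grad (- e) (phi (relabel -%R w)) (- x).
Proof. by rewrite /grad /mirror_field opprD. Qed.

Lemma Lop_mirror phi w x :
  Lop w (mirror_field phi w) x = Lop (relabel -%R w) (phi (relabel -%R w)) (- x).
Proof.
rewrite !LopE// -[RHS]big_stepsN; apply: eq_bigr => e _.
by rewrite grad_mirror wtN -mirror_shift wt_mirror.
Qed.

Lemma grad_norm_ge (u : Zd -> R) x e : unit_dir e -> `|grad e u x| <= grad_norm u x.
Proof.
move=> [i ei]; rewrite -sqrtr_sqr ler_wsqrtr// (bigD1 i)//=.
have S0 : 0 <= \sum_(j < d | j != i) (grad (unit_vec j) u x ^+ 2 + grad (- unit_vec j) u x ^+ 2).
  by apply: sumr_ge0 => j _; rewrite addr_ge0 ?sqr_ge0.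
have s1 := sqr_ge0 (grad (unit_vec i) u x).
have s2 := sqr_ge0 (grad (- unit_vec i) u x).
by case: ei => ->; lra.
Qed.

(** Since [phi0] sees only the matrix at the origin, its value at [- x] in the mirrored environment
    is read off [w x], as is its value at [x] in [w]. *)
Lemma gc_mirror g phi0 phi : (forall w, phi0 w = g (w 0)) ->
  global_corrector P Q phi0 phi ->
  {ae P, forall w, forall x, Lop w (mirror_field phi w) x = Lop w (phi w) x}.
Proof.
move=> phi0E [_ gcE _ _ _].
have mM := @measurable_relabel R d -%R.
apply: filterS2 gcE (ae_preserving mM (iid_mirror iidP) gcE) => w h1 h2 x.
rewrite Lop_mirror h1 h2 !phi0E; congr (g _ - _).
by rewrite /Defs.shift /relabel !addr0 opprK.
Qed.

Lemma gc_mirror_stationary phi0 phi : global_corrector P Q phi0 phi ->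
  {ae P, forall w, forall x e, unit_dir e ->
    grad e (mirror_field phi w) x = grad e (mirror_field phi (shift x w)) 0}.
Proof.
move=> [_ _ gcS _ _].
have mM := @measurable_relabel R d -%R.
apply: filterS (ae_preserving mM (iid_mirror iidP) gcS) => w h x e he.
rewrite !grad_mirror mirror_shift oppr0; apply: h.
by apply/stepsP; rewrite stepsN; exact/stepsP.
Qed.

Lemma pow4D (a b : R) : (a + b) ^+ 4 <= 8 * (a ^+ 4 + b ^+ 4).
Proof.
have h (x y : R) : (x + y) ^+ 2 <= 2 * (x ^+ 2 + y ^+ 2).
  by have := sqr_ge0 (x - y); nra.
rewrite (exprM _ 2 2) (exprM a 2 2) (exprM b 2 2).
have := h (a ^+ 2) (b ^+ 2).
have h1 := h a b.
have : (a + b) ^+ 2 ^+ 2 <= (2 * (a ^+ 2 + b ^+ 2)) ^+ 2.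
  by rewrite ler_sqr ?nnegrE ?sqr_ge0 ?mulr_ge0 ?addr_ge0 ?sqr_ge0.
nra.
Qed.

Lemma pow4_ge0 (a : R) : 0 <= a ^+ 4.
Proof. by rewrite exprn_even_ge0. Qed.

(** Fourth moments of the field, together with the second moment of [rho], control the second
    moments weighted by [rho]. *)
Definition int4_le (f : Env -> R) C := intR P (fun w => f w ^+ 4) /\ \int[P]_w f w ^+ 4 <= C.

Lemma int4_leD f g C C' : measurable_fun setT f -> measurable_fun setT g ->
  int4_le f C -> int4_le g C' -> int4_le (fun w => f w + g w) (8 * (C + C')).
Proof.
move=> mf mg [fi fC] [gi gC].
have i8 := intRZ 8 (intRD fi gi).
have fgi : intR P (fun w => (f w + g w) ^+ 4).
  apply: intR_le i8 _; first by apply: measurable_funX; exact: measurable_funD.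
  by move=> w; rewrite ger0_norm ?pow4_ge0// pow4D.
split=> //; apply: (@le_trans _ _ (\int[P]_w (8 * (f w ^+ 4 + g w ^+ 4)))).
  by apply: le_Rintegral => // w _; exact: pow4D.
rewrite RintegralZl//; last exact: intRD.
rewrite RintegralD//; lra.
Qed.

Lemma int4_leN f C : int4_le f C -> int4_le (fun w => - f w) C.
Proof.
suff E : (fun w => (- f w) ^+ 4) = (fun w => f w ^+ 4) by rewrite /int4_le E.
by apply/funext => w; ring.
Qed.

Lemma int4_le_mirror f C : int4_le f C -> int4_le (fun w => f (relabel -%R w)) C.
Proof.
move=> [fi fC]; have mM := @measurable_relabel R d -%R; split.
  exact: (integrable_preserving mM (iid_mirror iidP) fi).
by rewrite (Rintegral_preserving mM (iid_mirror iidP) fi).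
Qed.

(** Away from the origin, [growth^4 <= (1 + l1 x)^2] turns the normalised bound into quadratic
    growth of the fourth moment. *)
Lemma gc_int4 phi0 phi : global_corrector P Q phi0 phi ->
  exists C, [/\ 0 <= C, forall x, int4_le (phi ^~ x) (C * (1 + l1 x) ^+ 2) &
    forall x e, e \in steps -> int4_le (fun w => grad e (phi w) x) C].
Proof.
move=> [phim _ _ [q [c [B [q0 c0 gB]]]] [q' [c' [A [q'0 c'0 vA]]]]].
have [M M0 hM] := pow4_le_expR q0 c0.
have [M' M'0 hM'] := pow4_le_expR q'0 c'0.
have gm e x : measurable_fun setT (fun w => grad e (phi w) x) by exact: measurable_funB.
have grad_m x : measurable_fun setT (fun w => grad_norm (phi w) x).
  have -> : (fun w => grad_norm (phi w) x) = fun w => (\sum_i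
      (grad (unit_vec i) (phi w) x ^+ 2 + grad (- unit_vec i) (phi w) x ^+ 2)) `^ 2^-1.
    apply/funext => w; rewrite powR12_sqrt//.
    by apply: sumr_ge0 => i _; rewrite addr_ge0 ?sqr_ge0.
  apply: (measurableT_comp (f := fun r : R => r `^ 2^-1)) => //.
  apply: measurable_sum => i; apply: measurable_funD; exact: measurable_funX.
have G4 x e : e \in steps -> int4_le (fun w => grad e (phi w) x) (M * B).
  move=> es; have [gi gle] := int4_of_expectation (grad_m x) M0 hM (gB x).
  have le4 w : grad e (phi w) x ^+ 4 <= grad_norm (phi w) x ^+ 4.
    have /stepsP/(grad_norm_ge (phi w) x) := es.
    move=> /(lerXn2r 4); rewrite !nnegrE normr_ge0 sqrtr_ge0 => /(_ isT isT).
    by rewrite -normrX ger0_norm ?pow4_ge0.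
  have i4 : intR P (fun w => grad e (phi w) x ^+ 4).
    apply: intR_le gi _; first exact: measurable_funX.
    by move=> w; rewrite ger0_norm ?pow4_ge0.
  by split=> //; apply: le_trans gle; apply: le_Rintegral.
have V4 x : int4_le (fun w => phi w x / growth d (enorm R x)) (M' * A).
  apply: int4_of_expectation hM' (vA x) => //.
  exact: measurable_funM.
have A0 : 0 <= M' * A.
  have [_] := V4 0; apply: le_trans; apply: Rintegral_ge0 => w _; exact: pow4_ge0.
have e1s : unit_vec (Ordinal d_gt0) \in steps by exact: steps_unit.
set e1 := unit_vec _ in e1s.
have B0 : 0 <= M * B.
  have [_] := G4 0 _ e1s; apply: le_trans; apply: Rintegral_ge0 => w _; exact: pow4_ge0.
have F4 x : x != 0 -> int4_le (phi ^~ x) (M' * A * (1 + l1 x) ^+ 2).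
  move=> x0; have gx : growth d (enorm R x) != 0 by apply: growth_neq0; exact: enorm_gt0.
  set gr := growth d (enorm R x) in gx.
  have E : (fun w => phi w x ^+ 4) = fun w => gr ^+ 4 * (phi w x / gr) ^+ 4.
    by apply/funext => w; rewrite -exprMn mulrC divfK.
  have [vi vle] := V4 x; rewrite /int4_le E; split; first exact: intRZ.
  rewrite RintegralZl// mulrC ler_pM ?pow4_ge0//.
    by apply: Rintegral_ge0 => w _; exact: pow4_ge0.
  rewrite (exprM _ 2 2) ler_sqr ?nnegrE ?sqr_ge0 ?addr_ge0 ?l1_ge0//.
  by rewrite (le_trans (growth_sqr_le (enorm_ge0 x)))// lerD2l enorm_le_l1.
(* The largest of the constants, the one at the origin: [4] bounds [(1 + l1 e1)^2], [M * B] bounds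
   the gradient, and [8] comes from adding two fields. *)
exists (8 * (4 * (M' * A) + M * B)); split.
- by rewrite mulr_ge0// addr_ge0// mulr_ge0.
- move=> x; have [->|x0] := eqVneq x 0; last first.
    have [fi fle] := F4 x x0; split=> //; apply: (le_trans fle).
    by rewrite ler_wpM2r ?sqr_ge0//; lra.
  (* As [growth] may vanish at the origin, [phi] is controlled there by its value at the neighbour
     [e1] and one gradient. *)
  have -> : phi ^~ 0 = fun w => phi w e1 + - grad e1 (phi w) 0.
    by apply/funext => w; rewrite /grad add0r subKr.
  have e10 : e1 != 0 by apply/eqP => e10; have := steps_neqN e1s; rewrite e10 oppr0 eqxx.
  have [fi fle] := F4 _ e10.
  have fe : int4_le (phi ^~ e1) (4 * (M' * A)).
    split=> //; apply: (le_trans fle); rewrite mulrC ler_wpM2r//.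
    have := l1_steps e1s : l1 e1 <= 1 :> R; have := l1_ge0 e1 : 0 <= l1 e1 :> R; nra.
  have [hi hle] := int4_leD (phim e1) (measurable_funN (gm e1 0)) fe (int4_leN (G4 0 _ e1s)).
  by split=> //; apply: (le_trans hle); rewrite l1_0 addr0 expr1n mulr1.
- move=> x e es; have [gi gle] := G4 x e es; split=> //; apply: (le_trans gle).
  lra.
Qed.
End Corrector.

(** * Vanishing of the mean flux by mirror symmetry *)

Section MeanFlux.
Context {R : realType} {d : nat}.
Local Notation Zd := (lattice d).
Local Notation Env := (env R d).
Hypothesis d_gt0 : (0 < d)%N.
Variables (P Q : probability Env R) (iidP : iid P).
Variables (Pw : R.-pker Env ~> path_space d) (hPw : quenched_law Pw).
Hypothesis hQ : invariant_measure P Q Pw.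
Variables (rho : Env -> R) (hrho : density P Q rho) (rho_mom : density_moments P rho).
Implicit Types (w : Env) (x e : Zd).

Let S := \int[P]_w rho w ^+ 2.

Let rho_m : measurable_fun setT rho. Proof. by case: hrho. Qed.
Let rho_ge0 w : 0 <= rho w. Proof. by case: hrho. Qed.

Lemma density_sqr_int : intR P (fun w => rho w ^+ 2).
Proof.
have [c c0 hc] := rho_mom.
have [M M0 hM] := pow4_le_expR c0 ltr01.
have mE (a : R) : measurable_fun setT (fun w => expR (rho w `^ a)).
  apply: measurableT_comp => //.
  exact: (measurableT_comp (f := fun r : R => r `^ a)).
pose Er := ('E_P[fun w => expR (1 * `|rho w| `^ c)])%E.
have E1 : Er = ('E_P[fun w => expR (rho w `^ c)])%E.
  by congr expectation; apply/funext => w; rewrite mul1r ger0_norm.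
(* The assumption bounds a sum of two nonnegative expectations, and hence the first of them. *)
have Ef : Er \is a fin_num.
  rewrite E1 ge0_fin_numE; last by apply: expectation_ge0 => w; exact: expR_ge0.
  apply: le_lt_trans hc; rewrite leeDl//.
  by apply: expectation_ge0 => w; exact: expR_ge0.
have [] : int4_le P rho (M * fine Er).
  by apply: int4_of_expectation hM _ => //; rewrite fineK.
move=> r4 _; apply: intR_le (intRD (intR_cst P 1) r4) _; first exact: measurable_funX.
move=> w; rewrite ger0_norm ?sqr_ge0// (exprM _ 2 2).
have := sqr_ge0 (rho w ^+ 2 - 1); have := sqr_ge0 (rho w ^+ 2); nra.
Qed.

(** Young's inequality [rho f^2 <= b rho^2 + f^4 / b], where [b] is matched to the size of [f^2]: it
    is [1 + l1 y] for the field and [1] for its gradients. *)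
Lemma density_sqr_weighted f x C b : measurable_fun setT f -> 0 < b ->
  int4_le P f (C * b ^+ 2) ->
  intR P (fun w => rho (shift x w) * f w ^+ 2) /\
  \int[P]_w (rho (shift x w) * f w ^+ 2) <= (S + C) * b.
Proof.
move=> mf b0 [fi fle].
have si := intR_shift iidP x density_sqr_int.
have bi : 0 < b^-1 by rewrite invr_gt0.
have hi := intRD (intRZ b si) (intRZ b^-1 fi).
have le w : rho (shift x w) * f w ^+ 2 <= b * rho (shift x w) ^+ 2 + b^-1 * f w ^+ 4.
  set r := rho _; set t := f w.
  have h1 : 0 <= b^-1 * (b * r - t ^+ 2) ^+ 2 by rewrite mulr_ge0 ?sqr_ge0// ltW.
  have h2 : b^-1 * (b * r - t ^+ 2) ^+ 2 = b * r ^+ 2 - 2 * (r * t ^+ 2) + b^-1 * t ^+ 4.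
    by field; rewrite gt_eqF.
  have h3 : 0 <= r * t ^+ 2 by exact: mulr_ge0 (rho_ge0 _) (sqr_ge0 _).
  lra.
have ge0 w : 0 <= rho (shift x w) * f w ^+ 2 by rewrite mulr_ge0 ?sqr_ge0.
have ri : intR P (fun w => rho (shift x w) * f w ^+ 2).
  apply: intR_le hi _; last by move=> w; rewrite ger0_norm.
  apply: measurable_funM; last exact: measurable_funX.
  exact: measurableT_comp rho_m (@measurable_shift R d x).
split=> //; apply: (@le_trans _ _ (\int[P]_w (b * rho (shift x w) ^+ 2 + b^-1 * f w ^+ 4))).
  exact: le_Rintegral.
rewrite RintegralD//; [|exact: (intRZ b si)|exact: (intRZ b^-1 fi)].
rewrite RintegralZl// RintegralZl// (Rintegral_shift iidP x density_sqr_int) -/S.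
rewrite mulrDl lerD//; first by rewrite mulrC.
by rewrite ler_pdivrMl// mulrCA mulrA -mulrA -expr2.
Qed.

Section Flux.
Variables (phi0 : Env -> R) (phi : Env -> Zd -> R) (g : posDiag R d -> R).
Hypotheses (phi0E : forall w, phi0 w = g (w 0)) (gc : global_corrector P Q phi0 phi).

Let u w x := phi w x - mirror_field phi w x.

Let mM := @measurable_relabel R d -%R.

Let gradu e w x : grad e (u w) x = grad e (phi w) x - grad e (mirror_field phi w) x.
Proof. by rewrite /grad /u; ring. Qed.

(** The corrector and its mirror image solve the same equation, so their difference [u] is harmonic
    with stationary gradient, and the energy argument applies to it. *)
Lemma density_grad_symmetric e x : e \in steps ->
  {ae P, forall w, rho (shift x w) * grad e (phi w) x =
                   rho (shift x w) * grad e (mirror_field phi w) x}.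
Proof.
move=> es; have [QP _ statQ _] := hQ.
have [C [C0 p4 g4]] := gc_int4 d_gt0 gc.
have phim := gc_measurable gc.
have mirm y : measurable_fun setT (mirror_field phi ^~ y) by exact: measurableT_comp (phim (- y)) mM.
have um y : measurable_fun setT (u ^~ y) by exact: measurable_funB.
have gm e' y : measurable_fun setT (fun w => grad e' (u w) y) by exact: measurable_funB.
(* The constant is [16 C = 8 (C + C)], as the field and its mirror image obey the same bound. *)
have u4 y : int4_le P (u ^~ y) (16 * C * (1 + l1 y) ^+ 2).
  have [] := int4_leD (phim y) (measurable_funN (mirm y)) (p4 y)
    (int4_leN (int4_le_mirror iidP (p4 (- y)))).
  by rewrite l1N => ? ?; split=> //; lra.
have gu4 e' y : e' \in steps -> int4_le P (fun w => grad e' (u w) y) (16 * C * 1 ^+ 2).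
  move=> es'; rewrite (_ : (fun w => grad e' (u w) y) =
    fun w => grad e' (phi w) y + - grad (- e') (phi (relabel -%R w)) (- y)); last first.
    by apply/funext => w; rewrite gradu grad_mirror.
  have esN : - e' \in steps by rewrite stepsN.
  have gm' e0 z : measurable_fun setT (fun w => grad e0 (phi w) z) by exact: measurable_funB.
  have [] := int4_leD (gm' e' y) (measurable_funN (measurableT_comp (gm' (- e') (- y)) mM)) (g4 y _ es')
    (int4_leN (int4_le_mirror iidP (g4 (- y) _ esN))).
  by move=> ? ?; split=> //; lra.
have harm : {ae P, forall w, forall x, Lop w (u w) x = 0}.
  apply: filterS (gc_mirror d_gt0 iidP phi0E gc) => w hw y.
  rewrite LopE//; under eq_bigr do rewrite gradu mulrBr.
  by rewrite sumrB -!LopE// hw subrr.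
have stat : {ae P, forall w, forall x e, unit_dir e ->
    grad e (u w) x = grad e (u (shift x w)) 0}.
  apply: filterS2 (gc_stationary gc) (gc_mirror_stationary iidP gc) => w h1 h2 y e' he'.
  by rewrite !gradu (h1 y e' he') (h2 y e' he').
have l0 (y : Zd) : 0 < 1 + l1 y :> R by rewrite ltr_pwDl// l1_ge0.
have := @harmonic_grad_eq0 R d d_gt0 P iidP rho u (S + 16 * C) rho_m rho_ge0
  (density_adj d_gt0 iidP hPw statQ QP hrho) um harm stat
  (fun y => (density_sqr_weighted y (um y) (l0 y) (u4 y)).1)
  (fun y => (density_sqr_weighted y (um y) (l0 y) (u4 y)).2)
  (fun e' y es' => (density_sqr_weighted y (gm e' y) ltr01 (gu4 e' y es')).1) _ e x es.
move=> H; apply: filterS (H _) => [w|e' y es'].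
  by rewrite gradu mulrBr => /eqP; rewrite subr_eq0 => /eqP.
by have := (density_sqr_weighted y (gm e' y) ltr01 (gu4 e' y es')).2; rewrite mulr1.
Qed.

Let F j x w := rho (shift x w) * flux phi j x w.

Let Fi j x : intR P (F j x).
Proof.
have [C [C0 p4 g4]] := gc_int4 d_gt0 gc.
have phim := gc_measurable gc.
have gm e y : measurable_fun setT (fun w => grad e (phi w) y) by exact: measurable_funB.
have gi e : e \in steps -> intR P (fun w => wt (unit_vec j) (shift x w) * rho (shift x w) * grad e (phi w) x).
  move=> es.
  have mr : measurable_fun setT (fun w => rho (shift x w)).
    exact: measurableT_comp rho_m (@measurable_shift R d x).
  have g4' : int4_le P (fun w => grad e (phi w) x) (C * 1 ^+ 2) by rewrite expr1n mulr1; exact: g4.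
  have [ri _] := density_sqr_weighted x (gm e x) ltr01 g4'.
  have r1 := intR_shift iidP x (intR_density hrho).
  apply: intR_le (intRD r1 ri) _.
    apply: measurable_funM => //; apply: measurable_funM => //.
    exact: measurableT_comp (measurable_wt d_gt0 _) (@measurable_shift R d x).
  move=> w; have := wt_gt0 d_gt0 (shift x w) (steps_unit j).
  have := wt_le1 d_gt0 (shift x w) (steps_unit j).
  set a := wt _ _; set r := rho _; set t := grad _ _ _ => a1 a0.
  have r0 : 0 <= r := rho_ge0 _.
  rewrite -mulrA normrM gtr0_norm// -[leRHS]mul1r ler_pM ?(ltW a0)//.
  (* What remains is [|t| <= 1 + t^2], which bounds the integrand by [rho + rho t^2]. *)
  rewrite normrM ger0_norm// -[X in X + _]mulr1 -mulrDr ler_wpM2l//.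
  have := sqr_ge0 (t - 1); have := sqr_ge0 (t + 1).
  by rewrite ler_norml => *; apply/andP; split; nra.
have : intR P (fun w => 2 * (wt (unit_vec j) (shift x w) * rho (shift x w) * grad (unit_vec j) (phi w) x
    - wt (unit_vec j) (shift x w) * rho (shift x w) * grad (- unit_vec j) (phi w) x)).
  by apply: intRZ; apply: intRB; apply: gi; rewrite ?stepsN steps_unit.
congr intR; apply/funext => w; rewrite /F fluxE//; ring.
Qed.

Let F_shift j x : \int[P]_w F j x w = \int[P]_w F j 0 w.
Proof.
rewrite -[RHS](Rintegral_shift iidP x (Fi j 0)); apply: ae_Rintegral.
- exact: intR_measurable (Fi j x).
- exact: intR_measurable (intR_shift iidP x (Fi j 0)).
apply: filterS (gc_stationary gc) => w hw.
rewrite /F !fluxE// !env_shift0 (hw x (unit_vec j)) ?(hw x (- unit_vec j))//.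
- by exists j; right.
- by exists j; left.
Qed.

Lemma mean_flux_eq0 j x : mean_flux P rho phi j x = 0%E.
Proof.
have E : mean_flux P rho phi j x = (\int[P]_w F j x w)%:E.
  by rewrite /mean_flux unlock fineK//; exact: integrable_fin_num (Fi j x).
rewrite E; congr EFin.
(* By stationarity the means at [x] and [- x] coincide, so a mean equal to its opposite has to
   vanish. *)
suff : \int[P]_w F j x w = - \int[P]_w F j (- x) w.
  by rewrite (F_shift j (- x)) -(F_shift j x); lra.
have Fmi := integrable_preserving mM (iid_mirror iidP) (Fi j (- x)).
rewrite -(Rintegral_preserving mM (iid_mirror iidP) (Fi j (- x))).
rewrite -mulN1r -RintegralZl//.
apply: ae_Rintegral.
- exact: intR_measurable (Fi j x).
- exact: intR_measurable (intRZ (-1) Fmi).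
have uj := steps_unit j; have ujN : - unit_vec j \in steps by rewrite stepsN.
apply: filterS2 (filterI (density_grad_symmetric x uj) (density_grad_symmetric x ujN))
  (ae_shift iidP x (density_mirror d_gt0 iidP hPw hQ hrho)) => w [h1 h2] h3.
rewrite /F !fluxE// -mirror_shift h3 wt_mirror.
have -> : rho (shift x w) * (2 * wt (unit_vec j) (shift x w) *
    (grad (unit_vec j) (phi w) x - grad (- unit_vec j) (phi w) x)) =
  2 * wt (unit_vec j) (shift x w) * (rho (shift x w) * grad (unit_vec j) (phi w) x -
    rho (shift x w) * grad (- unit_vec j) (phi w) x) by ring.
(* Under the weight [rho] the gradients of [phi] may be replaced by those of its mirror image, which
   exchanges [unit_vec j] with its opposite and so changes the sign of the flux. *)
by rewrite h1 h2 !grad_mirror opprK; ring.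
Qed.

End Flux.
End MeanFlux.

Theorem proposition7 (R : realType) (d : nat) (hd : (3 <= d)%N)
    (P : probability (env R d) R)
    (A1 : iid P)
    (kappa : R) (kappa_gt0 : 0 < kappa) (kappa_le : kappa <= (2 * d%:R)^-1)
    (A2 : elliptic kappa P)
    (zeta : env R d -> R) (A3 : bounded_local P (psi_of zeta))
    (Pw : R.-pker (env R d) ~> path_space d) (hPw : quenched_law Pw)
    (Q : probability (env R d) R) (hQ : invariant_measure P Q Pw)
    (rho : env R d -> R) (hrho : density P Q rho)
    (hrho_mom : density_moments P rho)
    (v : 'I_d -> env R d -> lattice d -> R)
    (hv : forall k, global_corrector P Q (fun w => 2^-1 * acoef w 0 k k) (v k))
    (xi : env R d -> lattice d -> R)
    (hxi : global_corrector P Q (psi_of zeta) xi) :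
  forall j k : 'I_d,
    (forall x : lattice d, mean_flux P rho (v k) j x = 0%E) /\
    (forall x : lattice d, mean_flux P rho xi j x = 0%E).
Proof.
have d_gt0 : (0 < d)%N by exact: leq_trans hd.
move=> j k; split=> x.
  (* The witness [g] displays the right-hand side of the equation for [v k] as a function of the
     matrix at the origin. *)
  exact: (mean_flux_eq0 d_gt0 A1 hPw hQ hrho hrho_mom
    (g := fun M : posDiag R d => 2^-1 * ((\tr M)^-1 *: (M : 'M[R]_d)) k k) _ (hv k)).
have [[g _ gE] _] := A3.
exact: (mean_flux_eq0 d_gt0 A1 hPw hQ hrho hrho_mom gE hxi).
Qed.
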